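(* Let $\mathbf{k}$ be a field of characteristic zero, $V$ a finite-dimensional $\mathbf{k}$-vector space, and $R:V\otimes V\to V\otimes V$ a Hecke symmetry of birank $(1,1)$ with parameter $q$ not a root of unity of degree greater than $1$. Then $\dim_{\mathbf{k}}V=2$.
   Context: Hecke symmetry: an operator $R:V\otimes V\to V\otimes V$ satisfying the Yang–Baxter equation $(R\otimes \mathrm{id}_V)(\mathrm{id}_V\otimes R)(R\otimes \mathrm{id}_V)=(\mathrm{id}_V\otimes R)(R\otimes \mathrm{id}_V)(\mathrm{id}_V\otimes R)$, the Hecke equation $(R+\mathrm{id})(R-q\cdot\mathrm{id})=0$ with $q\in\mathbf{k}$, $q\neq0$, and closed, i.e. the half-dual operator $P=(\mathrm{ev}_V\otimes\mathrm{id}_{V\otimes V^*})(\mathrm{id}_{V^*}\otimes R\otimes\mathrm{id}_{V^*})(\mathrm{id}_{V^*\otimes V}\otimes\mathrm{db}_V):V^*\otimes V\to V\otimes V^*$ is invertible, where $\mathrm{ev}_V:V^*\otimes V\to\mathbf{k}$ is evaluation and $\mathrm{db}_V:\mathbf{k}\to V\otimes V^*$ is the dual-basis map. The quantum symmetric tensor algebra is the quotient of the tensor algebra $T(V)$ by the ideal generated by $\mathrm{Im}(R-q\cdot\mathrm{id})$; $S_n$ is its $n$-th homogeneous component. The Hecke symmetry $R$ has birank $(1,1)$ if the Poincaré series $\sum_n\dim_{\mathbf{k}}(S_n)t^n$ is of the form $(1+at)(1-bt)^{-1}$ with $a,b>0$. *)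

(* Defs.v *)
From HB Require Import structures.
From mathcomp Require Import all_boot all_order all_algebra.
From mathcomp Require Import reals.
From mathcomp Require Import finmap monalg.

Set Implicit Arguments.
Unset Strict Implicit.
Unset Printing Implicit Defensive.

Import GRing.Theory.

Local Open Scope ring_scope.

Declare Scope tensor_scope.
Delimit Scope tensor_scope with T.
Reserved Notation "V \ox W" (at level 40, left associativity).

Section TensorProduct.

Variable k : fieldType.
Implicit Types U V W Z : vectType k.

(* [bas V i] is the i-th vector of the library's reference basis of V, and
   [crd i v] the i-th coordinate of v in that basis. *)
Definition bas V (i : 'I_(\dim {:V})) : V := (vbasis {:V})`_i.
Definition crd V (i : 'I_(\dim {:V})) (v : V) : k^o := coord (vbasis {:V}) i v.

HB.instance Definition _ V i := GRing.Linear.copy (@crd V i) (@crd V i).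

(* V (x) W as the matrices of coefficients on the basis bas i (x) bas j; the
   universal property is [tliftE] together with [tens_ext]. *)
Definition tens V W : vectType k := 'M[k]_(\dim {:V}, \dim {:W}).

Local Notation "V \ox W" := (tens V W) : tensor_scope.
Local Open Scope tensor_scope.

Definition pure V W (v : V) (w : W) : V \ox W :=
  \matrix_(i, j) (crd i v * crd j w).

Definition tlift_fun V W U (f : V -> W -> U) (M : V \ox W) : U :=
  \sum_i \sum_j (M : 'M_(_, _)) i j *: f (bas i) (bas j).

Fact tlift_is_linear V W U (f : V -> W -> U) : linear (tlift_fun f).
Proof.
move=> a A B; rewrite /tlift_fun scaler_sumr -big_split; apply: eq_bigr => i _.
rewrite /= scaler_sumr -big_split; apply: eq_bigr => j _ /=.
by rewrite !mxE scalerDl scalerA.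
Qed.

HB.instance Definition _ V W U (f : V -> W -> U) :=
  GRing.isLinear.Build k (V \ox W) U *:%R (tlift_fun f) (tlift_is_linear f).

(* The linear map on V (x) W induced by a bilinear f. *)
Definition tlift V W U (f : V -> W -> U) : 'Hom(V \ox W, U) :=
  linfun (tlift_fun f).

Definition bilinear_map V W U (f : V -> W -> U) : Prop :=
  (forall w, linear (fun v => f v w)) /\ (forall v, linear (f v)).

Lemma crd_bas V (v : V) : v = \sum_i crd i v *: bas i.
Proof. by apply: coord_vbasis; rewrite memvf. Qed.

Lemma crd_basE V i j : crd i (bas j : V) = (i == j)%:R :> k.
Proof.
rewrite eq_sym; exact: (coord_free j i (basis_free (vbasisP {:V}))).
Qed.

Fact linear_sum_fun V U (f : V -> U) : linear f ->
  forall n (c : 'I_n -> k) (x : 'I_n -> V),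
  f (\sum_i c i *: x i) = \sum_i c i *: f (x i).
Proof.
move=> fl n c x; pose L := GRing.isLinear.Build k V U *:%R f fl.
pose g : {linear V -> U} := HB.pack f L.
rewrite -[f]/(g : V -> U) linear_sum; apply: eq_bigr => i _; exact: linearZ.
Qed.

Lemma tliftE V W U (f : V -> W -> U) : bilinear_map f ->
  forall v w, tlift f (pure v w) = f v w.
Proof.
case=> fl fr v w; rewrite lfunE /= /tlift_fun.
rewrite {2}(crd_bas v) (linear_sum_fun (fl w)); apply: eq_bigr => i _.
rewrite {2}(crd_bas w) (linear_sum_fun (fr (bas i))) scaler_sumr.
by apply: eq_bigr => j _; rewrite mxE scalerA.
Qed.

Lemma pure_bilinear V W : bilinear_map (@pure V W).
Proof.
split=> [w a x y|v a x y]; apply/matrixP => i j; rewrite !mxE linearP /=.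
  by rewrite mulrDl -mulrA.
by rewrite mulrDr mulrCA.
Qed.

Lemma tens_sum V W (M : V \ox W) :
  M = \sum_i \sum_j (M : 'M_(_, _)) i j *: pure (bas i) (bas j).
Proof.
rewrite [LHS](matrix_sum_delta (M : 'M_(_, _))).
apply: eq_bigr => i _; apply: eq_bigr => j _; congr (_ *: _).
by apply/matrixP => a b; rewrite !mxE !crd_basE -natrM mulnb.
Qed.

Lemma tens_ext V W U (f g : 'Hom(V \ox W, U)) :
  (forall v w, f (pure v w) = g (pure v w)) -> f = g.
Proof.
move=> fg; apply/lfunP => M; rewrite (tens_sum M) !linear_sum.
apply: eq_bigr => i _; rewrite !linear_sum; apply: eq_bigr => j _.
by rewrite !linearZ /= fg.
Qed.

Definition tmap V V' W W' (f : 'Hom(V, V')) (g : 'Hom(W, W')) :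
    'Hom(V \ox W, V' \ox W') :=
  tlift (fun v w => pure (f v) (g w)).

Definition tassoc U V W : 'Hom(U \ox V \ox W, U \ox (V \ox W)) :=
  tlift (fun t w => tlift (fun u v => pure u (pure v w)) t).

Definition tassocV U V W : 'Hom(U \ox (V \ox W), U \ox V \ox W) :=
  tlift (fun u t => tlift (fun v w => pure (pure u v) w) t).

Definition tunitl V : 'Hom(k^o \ox V, V) := 
  tlift (fun (a : k^o) (v : V) => (a : k) *: v).

Definition tunitrV V : 'Hom(V, V \ox k^o) := linfun (fun v => pure v (1 : k^o)).

Lemma tmapE V V' W W' (f : 'Hom(V, V')) (g : 'Hom(W, W')) v w :
  tmap f g (pure v w) = pure (f v) (g w).
Proof.
rewrite tliftE //; have [pl pr] := pure_bilinear V' W'.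
by split=> [z|z] a x y; rewrite linearP (pl, pr).
Qed.

Fact pure_linl V W (w : W) : linear (fun v : V => pure v w).
Proof. exact: (pure_bilinear V W).1. Qed.
Fact pure_linr V W (v : V) : linear (pure v : W -> V \ox W).
Proof. exact: (pure_bilinear V W).2. Qed.

Fact tlift_bilinear V W Z U (f : Z -> V -> W -> U) :
  (forall v w, linear (fun z => f z v w)) ->
  bilinear_map (fun z t => tlift (f z) t).
Proof.
move=> fl; split=> [t a x y|z a x y]; last by rewrite linearP.
rewrite !lfunE /= /tlift_fun scaler_sumr -big_split; apply: eq_bigr => i _ /=.
rewrite scaler_sumr -big_split; apply: eq_bigr => j _ /=.
by rewrite fl scalerDr !scalerA mulrC.
Qed.

Lemma tassocE U V W (u : U) (v : V) (w : W) :
  tassoc U V W (pure (pure u v) w) = pure u (pure v w).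
Proof.
have lf (u' : U) (v' : V) : linear (fun w' : W => pure u' (pure v' w')).
  by move=> a x y; rewrite !pure_linr.
have [h1 h2] := tlift_bilinear lf.
rewrite tliftE; last by split.
by rewrite tliftE //; split=> z a x y; rewrite ?pure_linl ?pure_linr.
Qed.

Lemma tassocVE U V W (u : U) (v : V) (w : W) :
  tassocV U V W (pure u (pure v w)) = pure (pure u v) w.
Proof.
have lf (v' : V) (w' : W) : linear (fun u' : U => pure (pure u' v') w').
  by move=> a x y; rewrite !pure_linl.
rewrite tliftE; last exact: tlift_bilinear lf.
by rewrite tliftE //; split=> z a x y; rewrite ?pure_linr ?pure_linl.
Qed.

Lemma tunitlE V (a : k^o) (v : V) : tunitl V (pure a v) = (a : k) *: v.
Proof.
rewrite tliftE //; split=> z b x y; first by rewrite scalerDl scalerA.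
by rewrite scalerDr !scalerA mulrC.
Qed.

Definition dual V : vectType k := 'Hom(V, k^o).

Definition ev V : 'Hom(dual V \ox V, k^o) :=
  tlift (fun (phi : dual V) (v : V) => (phi : 'Hom(V, k^o)) v).

Definition db V : 'Hom(k^o, V \ox dual V) :=
  linfun (fun a : k^o =>
    (a : k) *: \sum_i pure (bas i) (linfun (@crd V i) : dual V)).

End TensorProduct.

Notation "V \ox W" := (tens V W) : tensor_scope.

Section HeckeSymmetry.

Variables (k : fieldType) (V : vectType k).
Local Open Scope tensor_scope.
Local Open Scope lfun_scope.
Implicit Types R : 'End(V \ox V).

(* R (x) id_V and id_V (x) R as endomorphisms of (V (x) V) (x) V *)
Definition R12 R : 'End(V \ox V \ox V) := tmap R \1.
Definition R23 R : 'End(V \ox V \ox V) :=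
  tassocV V V V \o tmap \1 R \o tassoc V V V.

Definition yang_baxter R : Prop :=
  R12 R \o R23 R \o R12 R = R23 R \o R12 R \o R23 R.

Definition hecke_equation (q : k) R : Prop :=
  (R + \1) \o (R - q *: \1) = 0.

(* V* (x) V -> (V* (x) V) (x) (V (x) V* ) -> V* (x) ((V (x) V) (x) V* )
            -> V* (x) ((V (x) V) (x) V* ) -> (V* (x) V) (x) (V (x) V* )
            -> V (x) V* *)
Definition half_dual R : 'Hom(dual V \ox V, V \ox dual V) :=
  let D := dual V in
  tunitl (V \ox D)
  \o tmap (ev V) \1
  \o (tassocV D V (V \ox D) \o tmap \1 (tassoc V V D))
  \o tmap \1 (tmap R \1)
  \o (tmap \1 (tassocV V V D) \o tassoc D V (V \ox D))
  \o tmap \1 (db V)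
  \o tunitrV (D \ox V).

Definition hecke_symmetry (q : k) R : Prop :=
  [/\ yang_baxter R, q != 0, hecke_equation q R & bijective (half_dual R)].

End HeckeSymmetry.

Section QuantumSymmetricAlgebra.

Variables (k : fieldType) (V : vectType k).
Local Open Scope tensor_scope.

(* T(V) is realized as the free associative algebra on a basis of V, i.e. the
   monoid algebra of the free monoid on the basis indices. *)
Definition tensor_algebra := {malg k[{fmonom 'I_(\dim {:V})}]}.

HB.instance Definition _ := GRing.NzRing.on tensor_algebra.
HB.instance Definition _ := GRing.Lmodule.on tensor_algebra.
HB.instance Definition _ := GRing.Lalgebra.on tensor_algebra.

Fact tensor_algebra_scaleAr (c : k) (x y : tensor_algebra) :
  c *: (x * y) = x * (c *: y).
Proof.
suff cx : x * c%:MP = c%:MP * x.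
  by rewrite -(mul_malgC c y) mulrA cx -mulrA mul_malgC.
rewrite [LHS]fgmulgU [RHS]fgmulUg; apply: eq_bigr => m _.
by rewrite mulrC mulm1 mul1m.
Qed.

HB.instance Definition _ :=
  GRing.Lalgebra_isAlgebra.Build k tensor_algebra tensor_algebra_scaleAr.

Definition letter (i : 'I_(\dim {:V})) : tensor_algebra := mkmalgU (fmu i) 1.

Definition iota1 (v : V) : tensor_algebra := \sum_i crd i v *: letter i.

Definition iota2 (M : V \ox V) : tensor_algebra :=
  \sum_i \sum_j (M : 'M_(_, _)) i j *: (letter i * letter j).

Lemma iota2_pure (v w : V) : iota2 (pure v w) = iota1 v * iota1 w.
Proof.
rewrite /iota2 /iota1 mulr_suml; apply: eq_bigr => i _.
rewrite mulr_sumr; apply: eq_bigr => j _.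
by rewrite mxE -scalerAl -scalerAr scalerA.
Qed.

Definition homogeneous (n : nat) (x : tensor_algebra) : Prop :=
  forall m, m \in msupp x -> fdeg m = n.

Definition two_sided_ideal (A : nzRingType) (I : A -> Prop) : Prop :=
  [/\ I 0, forall x y, I x -> I y -> I (x + y),
      forall a x, I x -> I (a * x) & forall a x, I x -> I (x * a)].

Definition ideal_gen (A : nzRingType) (G : A -> Prop) (x : A) : Prop :=
  forall I : A -> Prop, two_sided_ideal I -> (forall g, G g -> I g) -> I x.

Definition qsym_ideal (q : k) (R : 'End(V \ox V)) : tensor_algebra -> Prop :=
  ideal_gen (fun x => exists2 t, t \in limg (R - q *: \1)%VF & x = iota2 t).

(* The image of the subspace U in the quotient A / I has dimension m: it has a
   basis consisting of the classes of e_0, ..., e_(m-1) in U. *)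
Definition dim_mod (A : lmodType k) (U I : A -> Prop) (m : nat) : Prop :=
  exists2 e : 'I_m -> A, forall i, U (e i) &
    forall x, U x -> exists! c : {ffun 'I_m -> k}, I (x - \sum_i c i *: e i).

Definition qsym_dim (q : k) (R : 'End(V \ox V)) (n m : nat) : Prop :=
  dim_mod (homogeneous n) (qsym_ideal q R) m.

(* The identity s = p / r of formal power series, i.e. s * r = p, for a
   polynomial r with invertible constant coefficient. *)
Definition series_eq_frac (F : fieldType) (s : nat -> F) (p r : {poly F}) :
    Prop :=
  forall n, \sum_(i < n.+1) s i * r`_(n - i) = p`_n.

Definition birank_1_1 (F : realType) (q : k) (R : 'End(V \ox V)) : Prop :=
  exists2 s : nat -> nat, forall n, qsym_dim q R n (s n) &
    exists a b : F, [/\ 0 < a, 0 < b &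
      series_eq_frac (fun n => (s n)%:R) (1 + a *: 'X) (1 - b *: 'X)].

End QuantumSymmetricAlgebra.

(* Main.v *)
From HB Require Import structures.
Require Import Defs.
From mathcomp Require Import all_boot all_order all_algebra.
From mathcomp Require Import reals.
From mathcomp Require Import finmap monalg.
From mathcomp Require Import ring zify.

Set Implicit Arguments.
Unset Strict Implicit.
Unset Printing Implicit Defensive.

Import GRing.Theory Num.Theory Order.TTheory passmx VectorInternalTheory.
Local Open Scope ring_scope.
Local Open Scope tensor_scope.

(** Let d = dim V and let s_n be the dimensions of the quantum symmetric powers,
    so that s_1 = a + b, s_2 = b s_1, s_3 = b s_2 and s_2^2 = s_1 s_3. The last
    identity says that the Schur functor of the partition (2,2) vanishes on V,
    and this together with the closedness of R forces d <= 2.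

    Let S2 and S3 be the spaces of q-symmetric tensors of degree 2 and 3, that
    is, of common eigenvectors of the operators R_i with eigenvalue q. The map
    R_3 + 1 from S3 (x) V to S2 (x) S2 is injective; comparing dimensions, it
    is onto (sym22_lift). Computing on its image one finds that the braiding
    R_2 R_1 R_3 R_2 of the two factors of S2 (x) S2 is a combination of the
    identity and of the symmetrization of R_2 (pair_braiding). Take half-duals
    of this relation, as maps from S2^* (x) S2. The half-dual of the braiding is
    injective, since it is built from four half-duals of R, which are invertible
    (pair_braid_closed). The half-duals of the identity and of R_2 factor
    through the partial trace S2^* (x) S2 -> V^* (x) V. Hence
    (dim S2)^2 <= d^2 (dim_sym2_le).

    The same argument applies to the eigenvalue -1, once s_2^2 = s_1 s_3 is
    known for the antisymmetric powers as well. This follows from comparing the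
    multiplicities of the symmetry type (2,1) in S2 (x) V and in its
    antisymmetric counterpart (sym3_dim_le). The two eigenspaces of R span
    V (x) V, so d^2 <= 2 d (card_le2). Finally d = 0 contradicts
    a + b = s_1 <= d, and d = 1 gives s_1 = 1 and 0 < s_2 = b < 1, which is not
    an integer.

    The bound on d uses s_2^2 = s_1 s_3 together with the inequalities s_1 <= d,
    dim S2 <= s_2 and s_3 <= dim S3. The hypothesis on q gives q + 1 <> 0 and
    q^2 + q + 1 <> 0, which make R diagonalizable and the symmetrizer of degree
    3 invertible on S3. *)

(** * Eigenvectors of two and three braided operators *)

Section Eigenspaces.

Variables (k : fieldType) (W : vectType k).
Implicit Types (T : 'End(W)) (x y : k).

Lemma mem_leigenspaceP T x w : reflect (T w = x *: w) (w \in leigenspace T x).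
Proof.
rewrite memv_ker add_lfunE opp_lfunE scale_lfunE id_lfunE subr_eq0.
exact: eqP.
Qed.

Definition quadratic T x y :=
  forall w, T (T w) = (x + y) *: T w - (x * y) *: w.

Lemma quadraticC T x y : quadratic T x y -> quadratic T y x.
Proof. by move=> Tq w; rewrite Tq (addrC y) (mulrC y). Qed.

End Eigenspaces.

Section LinearCombinations.

Variables (k : fieldType) (V W : vectType k).
Implicit Types (f : 'Hom(V, W)) (u v : V).

Lemma lfunD f u v : f (u + v) = f u + f v. Proof. exact: linearD. Qed.
Lemma lfunN f u : f (- u) = - f u. Proof. exact: linearN. Qed.
Lemma lfunZ f a u : f (a *: u) = a *: f u. Proof. exact: linearZ. Qed.

Lemma v2rD u v : v2r (u + v) = v2r u + v2r v. Proof. exact: linearD. Qed.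
Lemma v2rN u : v2r (- u) = - v2r u. Proof. exact: linearN. Qed.
Lemma v2rZ a u : v2r (a *: u) = a *: v2r u. Proof. exact: linearZ. Qed.
Lemma v2r0 : v2r (0 : V) = 0. Proof. exact: linear0. Qed.

End LinearCombinations.

Definition lfun_lin := (lfunD, lfunN, lfunZ).

(* An identity between linear combinations of vectors holds as soon as it holds
   for the coordinates, where it is an identity of scalars. *)
Ltac lin_comb := apply: (can_inj v2rK); apply/rowP => ?;
  rewrite ?(lfun_lin, v2rD, v2rN, v2rZ, v2r0) ?mxE; ring.

Section OneOperator.

Variables (k : fieldType) (W : vectType k) (T : 'End(W)) (x y : k).
Hypotheses (Tq : quadratic T x y) (xy : x - y != 0).

Lemma sub_eigenvector w : T (T w - y *: w) = x *: (T w - y *: w).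
Proof. rewrite !lfun_lin Tq; lin_comb. Qed.

Lemma leigenspace_cap0 : (leigenspace T x :&: leigenspace T y = 0)%VS.
Proof.
apply/eqP; rewrite -subv0; apply/subvP => w.
rewrite memv_cap memv0 => /andP[/mem_leigenspaceP wx /mem_leigenspaceP].
rewrite wx => /eqP; rewrite -subr_eq0 -scalerBl scaler_eq0 (negPf xy).
by [].
Qed.

Lemma leigenspace_dimD :
  (\dim (leigenspace T x) + \dim (leigenspace T y))%N = \dim {:W}.
Proof.
rewrite -dimv_disjoint_sum ?leigenspace_cap0 //; congr (\dim _).
apply/vspaceP => w; rewrite memvf.
have -> : w = (x - y)^-1 *: (T w - y *: w) + (x - y)^-1 *: (x *: w - T w).
  rewrite -scalerDr -[LHS]scale1r -(mulVf xy) -scalerA; congr (_ *: _).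
  lin_comb.
apply: memv_add; apply/memvZ/mem_leigenspaceP; first exact: sub_eigenvector.
by rewrite !lfun_lin Tq; lin_comb.
Qed.

End OneOperator.

Section TwoBraids.

Variables (k : fieldType) (W : vectType k) (T1 T2 : 'End(W)).

Definition braided := forall w, T1 (T2 (T1 w)) = T2 (T1 (T2 w)).

(** For x = q this is the space of q-symmetric tensors of degree 3, for x = -1
    that of q-antisymmetric ones; the lemmas are stated for any pair of
    eigenvalues x, y so that they apply to both. *)
Definition sym3 (x : k) : {vspace W} :=
  (leigenspace T1 x :&: leigenspace T2 x)%VS.

Lemma sym3P x w : reflect (T1 w = x *: w /\ T2 w = x *: w) (w \in sym3 x).
Proof.
rewrite memv_cap.
by apply: (iffP andP) => [] [/mem_leigenspaceP h1 /mem_leigenspaceP h2].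
Qed.

Hypothesis braid : braided.

Section Eigenvalues.

Variables x y : k.
Hypotheses (x0 : x != 0) (y0 : y != 0) (xy : x - y != 0).
Hypotheses (T1q : quadratic T1 x y) (T2q : quadratic T2 x y).

(** Applied to w, the two sides of the braid relation are x^2 T2 w and
    x T2 (T2 w), and the quadratic equation leaves x y (T2 w - x w) = 0. *)
Lemma sym3_of_eigen w :
  T1 w = x *: w -> T1 (T2 w) = x *: T2 w -> T2 w = x *: w.
Proof.
move=> T1w T1T2w; have := braid w.
rewrite T1w !lfunZ T1T2w !lfunZ T2q => e.
apply/eqP; rewrite -subr_eq0.
have /eqP: (x * y) *: (T2 w - x *: w) = 0.
  rewrite -[RHS](subrr (x *: (x *: T2 w))) {1}e; lin_comb.
by rewrite scaler_eq0 mulf_eq0 (negPf x0) (negPf y0).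
Qed.

(** The two sides of the braid relation are x^2 y w and x y^2 w. *)
Lemma eigen_mixed0 w : T1 w = x *: w -> T2 w = y *: w -> w = 0.
Proof.
move=> T1w T2w; have := braid w.
rewrite T1w T2w !lfunZ T1w T2w !lfunZ T1w T2w => /eqP.
rewrite -subr_eq0 => e; apply/eqP.
have : (x * y * (x - y)) *: w == 0 by apply: etrans e; congr (_ == _); lin_comb.
by rewrite scaler_eq0 !mulf_eq0 (negPf x0) (negPf y0) (negPf xy).
Qed.

(** An unnormalized multiple of the projection onto sym3, written with
    T_i - y, which is x - y times the projection onto the x-eigenspace of
    T_i. It acts on sym3 as the scalar (x - y) (x^2 - x y + y^2). *)
Definition symmetrizer w :=
  let A1 w := T1 w - y *: w in
  A1 (T2 (A1 w) - y *: A1 w) + (x * y) *: A1 w.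

(** The braid relation makes the symmetrizer invariant under exchange of T1
    and T2; hence its values are x-eigenvectors of both. *)
Lemma symmetrizerE w :
  let A2 w := T2 w - y *: w in
  symmetrizer w = A2 (T1 (A2 w) - y *: A2 w) + (x * y) *: A2 w.
Proof.
rewrite /symmetrizer /= !lfun_lin T1q T2q braid; lin_comb.
Qed.

Lemma symmetrizer_sym3 w : symmetrizer w \in sym3 x.
Proof.
apply/sym3P; split; last rewrite symmetrizerE /=; rewrite /symmetrizer /=.
  by rewrite lfunD lfunZ !(sub_eigenvector T1q); lin_comb.
by rewrite lfunD lfunZ !(sub_eigenvector T2q); lin_comb.
Qed.

Hypothesis q3 : x ^+ 2 - x * y + y ^+ 2 != 0.

(** Modulo the images of T1 - x and T2 - x the operators T_i - y become the
    scalar x - y, so that the symmetrizer becomes an invertible scalar: every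
    vector is congruent to an element of sym3. *)
Lemma sym3_cover :
  (sym3 x + (limg (T1 - x *: \1)%VF + limg (T2 - x *: \1)%VF) = fullv)%VS.
Proof.
have TE (T : 'End(W)) u : T u - x *: u \in limg (T - x *: \1)%VF.
  have -> : T u - x *: u = (T - x *: \1)%VF u.
    by rewrite add_lfunE opp_lfunE scale_lfunE id_lfunE.
  by rewrite memv_img ?memvf.
apply/vspaceP => w; rewrite memvf.
pose c := (x - y) * (x ^+ 2 - x * y + y ^+ 2).
have c0 : c != 0 by rewrite mulf_neq0.
have -> : w = c^-1 *: symmetrizer w + c^-1 *: (c *: w - symmetrizer w).
  rewrite -scalerDr -[LHS]scale1r -(mulVf c0) -scalerA; congr (_ *: _).
  lin_comb.
apply: memv_add; apply: memvZ; first exact: symmetrizer_sym3.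
pose u1 := T1 w - y *: w; pose u2 := T2 u1 - y *: u1.
have -> : c *: w - symmetrizer w =
    - (T1 (u2 + (x * y) *: w) - x *: (u2 + (x * y) *: w))
    - (x - y) ^+ 2 *: (T1 w - x *: w)
    + (x - y) *: - (T2 u1 - x *: u1).
  rewrite /symmetrizer /c /u2 /u1 /= !lfun_lin ?T1q; lin_comb.
apply: memv_add; last by rewrite memvZ // memvN.
by rewrite memvB ?memvN ?memvZ.
Qed.

End Eigenvalues.

Variables x y : k.
Hypotheses (x0 : x != 0) (y0 : y != 0) (xy : x - y != 0).
Hypotheses (T1q : quadratic T1 x y) (T2q : quadratic T2 x y).
Hypothesis q3 : x ^+ 2 - x * y + y ^+ 2 != 0.

(** The map g = (T1 - y) T2 carries the y-eigenspace of T1 into the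
    x-eigenspace. It kills exactly sym3 y, and its image meets sym3 x trivially
    because the symmetrizer vanishes on it but is invertible on sym3 x. In
    representation theoretic terms, each copy of the mixed symmetry type (2,1)
    meets both eigenspaces in a line. *)
Lemma sym3_dim_le :
  (\dim (leigenspace T1 y) + \dim (sym3 x)
     <= \dim (leigenspace T1 x) + \dim (sym3 y))%N.
Proof.
pose g := ((T1 - y *: \1) \o T2)%VF.
have gE w : g w = T1 (T2 w) - y *: T2 w.
  by rewrite comp_lfunE add_lfunE opp_lfunE scale_lfunE id_lfunE.
rewrite -(limg_ker_dim g (leigenspace T1 y)).
have -> : (leigenspace T1 y :&: lker g = sym3 y)%VS.
  apply/vspaceP => w; rewrite memv_cap memv_ker gE.
  apply/andP/sym3P => [[/mem_leigenspaceP wy]|[wy wy2]].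
    rewrite subr_eq0 => /eqP gw; split=> //.
    by apply: (sym3_of_eigen y0 x0 _ wy gw); apply: quadraticC.
  split; first exact/mem_leigenspaceP.
  by rewrite wy2 lfunZ wy subrr.
rewrite -addnA addnC leq_add2r -dimv_disjoint_sum.
  apply/dimvS; rewrite subv_add; apply/andP; split; last first.
    by apply/subvP => w; rewrite memv_cap => /andP[].
  apply/subvP => _ /memv_imgP[u _ ->]; apply/mem_leigenspaceP.
  by rewrite gE (sub_eigenvector T1q).
apply/eqP; rewrite -subv0; apply/subvP => z; rewrite memv_cap memv0.
move=> /andP[/memv_imgP[u /mem_leigenspaceP uy]]; rewrite gE => zE.
move=> /sym3P[z1 z2].
have : ((x - y) * (x ^+ 2 - x * y + y ^+ 2)) *: z == 0.
  apply/eqP; transitivity (symmetrizer x y z).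
    by rewrite /symmetrizer /= !(z1, z2, lfun_lin); lin_comb.
  rewrite zE; transitivity ((x - y) *: symmetrizer x y (T2 u)).
    by rewrite /symmetrizer /= !(T1q, lfun_lin); lin_comb.
  transitivity (((x - y) * x) *: symmetrizer x y u).
    by rewrite !(symmetrizerE T1q T2q) /= !(T2q, lfun_lin); lin_comb.
  by rewrite /symmetrizer /= uy subrr !(scaler0, linear0, subr0, addr0).
by rewrite scaler_eq0 mulf_eq0 (negPf xy) (negPf q3).
Qed.

End TwoBraids.

(** On tensors symmetric in each of two adjacent pairs, the braiding
    T2 T1 T3 T2 of the pairs, the identity and the symmetrization of T2 satisfy
    no linear relation valid in all modules over the Hecke algebra. They do where
    the symmetry type (2,2) is absent, in particular in the module generated by a
    vector w that is symmetric in the first three places. *)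
Lemma pair_braiding (k : fieldType) (W : vectType k) (T1 T2 T3 : 'End(W))
    (x y : k) (w : W) :
    (forall u, T1 (T2 (T1 u)) = T2 (T1 (T2 u))) ->
    (forall u, T2 (T3 (T2 u)) = T3 (T2 (T3 u))) ->
    (forall u, T1 (T3 u) = T3 (T1 u)) -> quadratic T3 x y ->
    T1 w = x *: w -> T2 w = x *: w ->
  let v := T3 w - y *: w in
  let u := T3 (T2 v) - y *: T2 v in
  (x - y) *: T2 (T1 (T3 (T2 v))) =
    x ^+ 2 *: (T1 u - y *: u) + (x ^+ 3 * y * (x - y)) *: v.
Proof.
move=> b12 b23 c13 q3 w1 w2 v u.
have b232 : T3 (T2 (T3 w)) = x *: T2 (T3 w) by rewrite -b23 w2 !lfunZ.
have uE : u = (x - y) *: T2 (T3 w) - (x * y) *: v.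
  by rewrite /u /v !(lfun_lin, w2, b232); lin_comb.
have T1v : T1 v = x *: v by rewrite /v !(lfun_lin, c13, w1); lin_comb.
have Bv : T2 (T1 (T3 (T2 v))) = x ^+ 2 *: (T1 (T2 (T3 w)) - y *: T2 (T3 w)).
  rewrite /v !(lfun_lin, w2, b232) -b12 c13 w1 !lfunZ.
  lin_comb.
rewrite Bv uE !(lfun_lin, T1v); lin_comb.
Qed.

(** * Tensors in coordinates *)

Section LinearMaps.

Variables (k : fieldType) (V W : vectType k) (f : V -> W) (fl : linear f).

Let f_lin := GRing.isLinear.Build k V W *:%R f fl.

Definition lin_hom : 'Hom(V, W) := linfun (HB.pack f f_lin : {linear V -> W}).

Lemma lin_homE v : lin_hom v = f v. Proof. by rewrite lfunE. Qed.

End LinearMaps.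

Section FunctionSpaces.

Variable k : fieldType.
Implicit Types J : finType.

(** Coordinate model of tensor powers: a tensor is the function sending a
    tuple of basis indices to its coefficient. *)
Definition fspace J : vectType k := {ffun J -> k^o}.

Lemma dim_fspace J : \dim {:fspace J} = #|J|.
Proof. by rewrite dimvf -[LHS]/(#|J| * 1)%N muln1. Qed.

Lemma fspaceD J (u v : fspace J) j : (u + v) j = u j + v j :> k.
Proof. by rewrite ffunE. Qed.
Lemma fspaceN J (u : fspace J) j : (- u) j = - u j :> k.
Proof. by rewrite ffunE. Qed.
Lemma fspaceZ J a (u : fspace J) j : (a *: u) j = a * u j :> k.
Proof. by rewrite ffunE. Qed.
Lemma fspace0 J j : (0 : fspace J) j = 0 :> k.
Proof. by rewrite ffunE. Qed.
Lemma fspace_sum J (T : Type) (s : seq T) (P : pred T) (F : T -> fspace J) j :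
  (\sum_(t <- s | P t) F t) j = \sum_(t <- s | P t) F t j :> k.
Proof. by elim/big_rec2: _ => [|t a b _ <-]; rewrite ffunE. Qed.

Definition pairing J (f g : fspace J) : k := \sum_j f j * g j.

(** A function annihilating the image of T - x is an x-eigenvector of the
    adjoint, and the annihilator has the dimension of the kernel of T - x. *)
Lemma leigenspace_adjoint J (T T' : 'End(fspace J)) x :
    (forall f g, pairing (T' f) g = pairing f (T g)) ->
  (\dim (leigenspace T x) <= \dim (leigenspace T' x))%N.
Proof.
move=> adj; pose M := limg (T - x *: \1)%VF.
pose rho_fun (f : fspace J) : fspace 'I_(\dim M) :=
  [ffun i : 'I_(\dim M) => pairing f (vbasis M)`_i].
have rho_lin : linear rho_fun.
  move=> a f g; apply/ffunP => i; rewrite fspaceD fspaceZ !ffunE.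
  rewrite /pairing mulr_sumr -big_split; apply: eq_bigr => j _ /=.
  by rewrite fspaceD fspaceZ mulrDl mulrA.
pose rho := lin_hom rho_lin.
have rhoE f i : rho f i = pairing f (vbasis M)`_i by rewrite lin_homE ffunE.
have dM : (\dim (leigenspace T x) + \dim M = #|J|)%N.
  by have := limg_ker_dim (T - x *: \1)%VF fullv; rewrite capfv dim_fspace.
have := limg_ker_dim rho fullv; rewrite capfv dim_fspace => dr.
have : (\dim (lker rho) <= \dim (leigenspace T' x))%N.
  apply/dimvS/subvP => f; rewrite memv_ker => /eqP f0; apply/mem_leigenspaceP.
  have annM g : g \in M -> pairing f g = 0.
    move=> gM; rewrite (coord_vbasis gM) /pairing.
    under eq_bigr => j _ do rewrite fspace_sum mulr_sumr.
    rewrite exchange_big big1 //= => i _.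
    have := congr1 (fun h : fspace _ => h i) f0.
    rewrite rhoE fspace0 => e.
    transitivity (coord (vbasis M) i g * pairing f (vbasis M)`_i); last first.
      by rewrite e mulr0.
    rewrite /pairing mulr_sumr; apply: eq_bigr => j _.
    by rewrite fspaceZ mulrCA.
  apply/ffunP => j; apply/eqP; rewrite -subr_eq0; apply/eqP.
  pose dj : fspace J := [ffun i => (i == j)%:R].
  have pj (g : fspace J) : pairing g dj = g j.
    rewrite /pairing (bigD1 j) //= big1 ?ffunE ?eqxx ?mulr1 ?addr0 // => i ij.
    by rewrite ffunE (negPf ij) mulr0.
  rewrite -(annM ((T - x *: \1)%VF dj)); last by rewrite memv_img ?memvf.
  rewrite add_lfunE opp_lfunE scale_lfunE id_lfunE.
  transitivity (pairing f (T dj) - x * pairing f dj).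
    by rewrite -adj !pj fspaceZ.
  rewrite /pairing mulr_sumr -sumrB; apply: eq_bigr => i _.
  by rewrite fspaceD fspaceN fspaceZ mulrDr mulrN mulrCA.
have : (\dim (limg rho) <= \dim M)%N.
  by rewrite -[leqRHS]card_ord -dim_fspace dimvS ?subvf.
by move: dM dr; lia.
Qed.

(** The maps h and (g1, g2) are mutually inverse bijections between J1 x J2 and
    J. Keeping them as parameters lets the same index tuple be cut in different
    places. *)
Section TensorProductOfSubspaces.

Variables (J1 J2 J : finType) (h : J1 -> J2 -> J) (g1 : J -> J1) (g2 : J -> J2).
Hypotheses (hK : forall j, h (g1 j) (g2 j) = j).
Hypotheses (g1K : forall a b, g1 (h a b) = a) (g2K : forall a b, g2 (h a b) = b).
Variables (U1 : {vspace fspace J1}) (U2 : {vspace fspace J2}).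

Local Notation e1 := (vbasis U1).
Local Notation e2 := (vbasis U2).

Definition tensv_fun (X : 'M[k]_(\dim U1, \dim U2)) : fspace J :=
  [ffun j => \sum_a \sum_b X a b * (e1`_a (g1 j) * e2`_b (g2 j))].

Fact tensv_fun_is_linear : linear tensv_fun.
Proof.
move=> c X Y; apply/ffunP => j; rewrite fspaceD fspaceZ !ffunE.
rewrite mulr_sumr -big_split; apply: eq_bigr => a _ /=.
rewrite mulr_sumr -big_split; apply: eq_bigr => b _ /=.
by rewrite !mxE mulrDl -mulrA.
Qed.

HB.instance Definition _ :=
  GRing.isLinear.Build k _ _ *:%R tensv_fun tensv_fun_is_linear.

Definition tensv : {vspace fspace J} := limg (linfun tensv_fun).

Definition slice1 (w : fspace J) (b : J2) : fspace J1 := [ffun a => w (h a b)].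
Definition slice2 (w : fspace J) (a : J1) : fspace J2 := [ffun b => w (h a b)].

Lemma dim_tensv : \dim tensv = (\dim U1 * \dim U2)%N.
Proof.
rewrite limg_dim_eq; first by rewrite dimvf.
apply/eqP; rewrite -subv0; apply/subvP => X; rewrite memv_cap memvf memv0 /=.
rewrite memv_ker lfunE /= => /eqP X0; apply/eqP/matrixP => a b; rewrite mxE.
have fr1 := basis_free (vbasisP U1); have fr2 := basis_free (vbasisP U2).
have := elimT freeP fr1 (X^~ b); apply; apply/ffunP => j1; rewrite fspace0.
rewrite fspace_sum.
under eq_bigr => i _ do rewrite fspaceZ.
have := elimT freeP fr2 (fun b => \sum_i X i b * e1`_i j1); apply.
apply/ffunP => j2; rewrite fspace0 fspace_sum.
have := congr1 (fun w : fspace J => w (h j1 j2)) X0.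
rewrite fspace0 ffunE exchange_big => e; rewrite -[RHS]e; apply: eq_bigr => i _ /=.
rewrite fspaceZ mulr_suml; apply: eq_bigr => i' _.
by rewrite g1K g2K mulrA.
Qed.

Lemma tensvP w :
  reflect ((forall b, slice1 w b \in U1) /\ (forall a, slice2 w a \in U2))
          (w \in tensv).
Proof.
apply: (iffP idP) => [/memv_imgP[X _ ->]|[w1 w2]].
  rewrite lfunE /=; split=> j.
    have -> : slice1 (tensv_fun X) j = \sum_a (\sum_b X a b * e2`_b j) *: e1`_a.
      apply/ffunP => i; rewrite !ffunE fspace_sum; apply: eq_bigr => a _.
      rewrite fspaceZ mulr_suml; apply: eq_bigr => b _.
      by rewrite g1K g2K -!mulrA [X in _ * X]mulrC.
    by apply: memv_suml => a _; rewrite memvZ // vbasis_mem ?mem_nth ?size_tuple.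
  have -> : slice2 (tensv_fun X) j = \sum_b (\sum_a X a b * e1`_a j) *: e2`_b.
    apply/ffunP => i; rewrite !ffunE fspace_sum exchange_big.
    apply: eq_bigr => b _ /=; rewrite fspaceZ mulr_suml; apply: eq_bigr => a _.
    by rewrite g1K g2K mulrA.
  by apply: memv_suml => a _; rewrite memvZ // vbasis_mem ?mem_nth ?size_tuple.
(* The coordinates of the slices of w in U1 are themselves elements of U2, as
   linear combinations of slices in the other direction. *)
pose c a : fspace J2 := [ffun j2 => coord e1 a (slice1 w j2)].
have cU a : c a \in U2.
  pose d j1 : fspace J1 := [ffun i => (i == j1)%:R].
  have -> : c a = \sum_j1 coord e1 a (d j1) *: slice2 w j1.
    apply/ffunP => j2; rewrite ffunE fspace_sum.
    have -> : slice1 w j2 = \sum_j1 w (h j1 j2) *: d j1.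
      apply/ffunP => i; rewrite fspace_sum (bigD1 i) //= big1 => [|j ji].
        by rewrite fspaceZ !ffunE eqxx mulr1 addr0.
      by rewrite fspaceZ ffunE eq_sym (negPf ji) mulr0.
    rewrite linear_sum; apply: eq_bigr => j1 _.
    by rewrite linearZ fspaceZ ffunE /= mulrC.
  by apply: memv_suml => j1 _; rewrite memvZ.
apply/memv_imgP; exists (\matrix_(a, b) coord e2 b (c a)); first exact: memvf.
rewrite lfunE; apply/ffunP => j; rewrite ffunE.
transitivity (slice1 w (g2 j) (g1 j)); first by rewrite ffunE hK.
rewrite {1}(coord_vbasis (w1 (g2 j))) fspace_sum; apply: eq_bigr => a _.
rewrite fspaceZ; have -> : coord e1 a (slice1 w (g2 j)) = c a (g2 j).
  by rewrite ffunE.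
rewrite {1}(coord_vbasis (cU a)) fspace_sum mulr_suml; apply: eq_bigr => b _.
by rewrite fspaceZ mxE -mulrA [X in _ * X]mulrC.
Qed.

End TensorProductOfSubspaces.
End FunctionSpaces.

(** * A tensor with four indices acting on tensor powers *)

Section LocalOperators.

Variables (k : fieldType) (I : finType).
Implicit Types r : I -> I -> I -> I -> k.

(** The entry r a b c d is the coefficient of e_a (x) e_b in the image of
    e_c (x) e_d. *)
Definition act r (f : I -> I -> k) (a b : I) : k :=
  \sum_c \sum_d r a b c d * f c d.

Lemma eq_act r f g a b : (forall c d, f c d = g c d) -> act r f a b = act r g a b.
Proof.
by move=> fg; apply: eq_bigr => c _; apply: eq_bigr => d _; rewrite fg.
Qed.

(** An operator on two tensor places: p and q read the two indices in the tuple
    j, and u j a b overwrites them by a and b. *)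
Section Places.

Variables (J : finType) (p q : J -> I) (u : J -> I -> I -> J).

Definition at_places_fun r (w : fspace k J) : fspace k J :=
  [ffun j : J => act r (fun a b => w (u j a b)) (p j) (q j)].

Fact at_places_linear r : linear (at_places_fun r).
Proof.
move=> c v w; apply/ffunP => j; rewrite fspaceD fspaceZ !ffunE /act.
rewrite mulr_sumr -big_split; apply: eq_bigr => a _ /=.
rewrite mulr_sumr -big_split; apply: eq_bigr => b _ /=.
by rewrite fspaceD fspaceZ mulrDr mulrCA.
Qed.

Definition at_places r : 'End(fspace k J) := lin_hom (at_places_linear r).

Lemma at_placesE r w j :
  at_places r w j = act r (fun a b => w (u j a b)) (p j) (q j).
Proof. by rewrite lin_homE ffunE. Qed.

Definition hecke_tensor r x y := forall f a b,
  act r (act r f) a b = (x + y) * act r f a b - x * y * f a b.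

Lemma at_places_quadratic r x y :
    (forall j a b, p (u j a b) = a /\ q (u j a b) = b) ->
    (forall j a b c d, u (u j a b) c d = u j c d) ->
    (forall j, u j (p j) (q j) = j) ->
  hecke_tensor r x y -> quadratic (at_places r) x y.
Proof.
move=> pqu uu upq hr w; apply/ffunP => j.
rewrite fspaceD fspaceN !fspaceZ !at_placesE.
rewrite -[in X in _ = _ - X](upq j) -(hr (fun a b => w (u j a b))).
apply: eq_act => c d; rewrite at_placesE.
have [-> ->] := pqu j c d.
by apply: eq_act => c' d'; rewrite uu.
Qed.

End Places.

Definition op2 r : 'End(fspace k (I * I)%type) :=
  at_places fst snd (fun _ a b => (a, b)) r.

Lemma op2E r w a b : op2 r w (a, b) = act r (fun a b => w (a, b)) a b.
Proof. exact: at_placesE. Qed.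

Definition op3_1 r : 'End(fspace k (I * I * I)%type) :=
  at_places (fun j => j.1.1) (fun j => j.1.2) (fun j a b => (a, b, j.2)) r.
Definition op3_2 r : 'End(fspace k (I * I * I)%type) :=
  at_places (fun j => j.1.2) snd (fun j a b => (j.1.1, a, b)) r.

Lemma op3_1E r w a b c :
  op3_1 r w (a, b, c) = act r (fun a b => w (a, b, c)) a b.
Proof. exact: at_placesE. Qed.
Lemma op3_2E r w a b c :
  op3_2 r w (a, b, c) = act r (fun b c => w (a, b, c)) b c.
Proof. exact: at_placesE. Qed.

Definition op4_1 r : 'End(fspace k (I * I * I * I)%type) :=
  at_places (fun j => j.1.1.1) (fun j => j.1.1.2)
            (fun j a b => (a, b, j.1.2, j.2)) r.
Definition op4_2 r : 'End(fspace k (I * I * I * I)%type) :=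
  at_places (fun j => j.1.1.2) (fun j => j.1.2)
            (fun j a b => (j.1.1.1, a, b, j.2)) r.
Definition op4_3 r : 'End(fspace k (I * I * I * I)%type) :=
  at_places (fun j => j.1.2) snd (fun j a b => (j.1.1, a, b)) r.

Lemma op4_1E r w a b c d :
  op4_1 r w (a, b, c, d) = act r (fun a b => w (a, b, c, d)) a b.
Proof. exact: at_placesE. Qed.
Lemma op4_2E r w a b c d :
  op4_2 r w (a, b, c, d) = act r (fun b c => w (a, b, c, d)) b c.
Proof. exact: at_placesE. Qed.
Lemma op4_3E r w a b c d :
  op4_3 r w (a, b, c, d) = act r (fun c d => w (a, b, c, d)) c d.
Proof. exact: at_placesE. Qed.

Section Hecke.

Variables (r : I -> I -> I -> I -> k) (x y : k).
Hypothesis hr : hecke_tensor r x y.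

Lemma op2_quadratic : quadratic (op2 r) x y.
Proof. by apply: at_places_quadratic hr => // -[]. Qed.
Lemma op3_1_quadratic : quadratic (op3_1 r) x y.
Proof. by apply: at_places_quadratic hr => // -[[]]. Qed.
Lemma op3_2_quadratic : quadratic (op3_2 r) x y.
Proof. by apply: at_places_quadratic hr => // -[[]]. Qed.
Lemma op4_3_quadratic : quadratic (op4_3 r) x y.
Proof. by apply: at_places_quadratic hr => // -[[[]]]. Qed.

End Hecke.

Section Braid.

Variable r : I -> I -> I -> I -> k.
Hypothesis br : braided (op3_1 r) (op3_2 r).

Lemma op4_braid12 w :
  op4_1 r (op4_2 r (op4_1 r w)) = op4_2 r (op4_1 r (op4_2 r w)).
Proof.
apply/ffunP => -[[[a b] c] d].
pose s (v : fspace k (I * I * I * I)%type) : fspace k (I * I * I)%type :=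
  [ffun j : I * I * I => v (j, d)].
have s1 v : s (op4_1 r v) = op3_1 r (s v).
  apply/ffunP => -[[a' b'] c']; rewrite op3_1E ffunE op4_1E.
  by apply: eq_act => ? ?; rewrite ffunE.
have s2 v : s (op4_2 r v) = op3_2 r (s v).
  apply/ffunP => -[[a' b'] c']; rewrite op3_2E ffunE op4_2E.
  by apply: eq_act => ? ?; rewrite ffunE.
have := congr1 (fun v : fspace k _ => v (a, b, c)) (br (s w)).
by rewrite -!(s1, s2) !ffunE.
Qed.

Lemma op4_braid23 w :
  op4_2 r (op4_3 r (op4_2 r w)) = op4_3 r (op4_2 r (op4_3 r w)).
Proof.
apply/ffunP => -[[[d a] b] c].
pose s (v : fspace k (I * I * I * I)%type) : fspace k (I * I * I)%type :=
  [ffun j : I * I * I => v (d, j.1.1, j.1.2, j.2)].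
have s1 v : s (op4_2 r v) = op3_1 r (s v).
  apply/ffunP => -[[a' b'] c']; rewrite op3_1E ffunE op4_2E.
  by apply: eq_act => ? ?; rewrite ffunE.
have s2 v : s (op4_3 r v) = op3_2 r (s v).
  apply/ffunP => -[[a' b'] c']; rewrite op3_2E ffunE op4_3E.
  by apply: eq_act => ? ?; rewrite ffunE.
have := congr1 (fun v : fspace k _ => v (a, b, c)) (br (s w)).
by rewrite -!(s1, s2) !ffunE.
Qed.

End Braid.

Lemma op4_comm13 r w : op4_1 r (op4_3 r w) = op4_3 r (op4_1 r w).
Proof.
apply/ffunP => -[[[a b] c] d]; rewrite op4_1E op4_3E.
transitivity (\sum_a' \sum_b' \sum_c' \sum_d'
                r a b a' b' * (r c d c' d' * w (a', b', c', d'))).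
  apply: eq_bigr => a' _; apply: eq_bigr => b' _.
  rewrite op4_3E mulr_sumr; apply: eq_bigr => c' _; exact: mulr_sumr.
under eq_bigr => a' _ do rewrite exchange_big.
rewrite exchange_big; apply: eq_bigr => c' _ /=.
under eq_bigr => a' _ do rewrite exchange_big.
rewrite exchange_big; apply: eq_bigr => d' _ /=.
rewrite op4_1E /act mulr_sumr; apply: eq_bigr => a' _.
by rewrite mulr_sumr; apply: eq_bigr => b' _; rewrite mulrCA.
Qed.

End LocalOperators.

(** * The half-dual of the braiding of pairs *)

Section Closed.

Variables (k : fieldType) (I : finType) (r : I -> I -> I -> I -> k).
Notation W2 := (fspace k (I * I)%type).
Notation W4 := (fspace k (I * I * I * I)%type).

(** Injectivity of the half-dual operator in coordinates: the first output and
    the first input of R are summed against Y, the second ones stay free. *)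
Definition closed_tensor := forall Y : I -> I -> k,
  (forall e g, \sum_a \sum_c Y a c * r a e c g = 0) -> forall a c, Y a c = 0.

Definition pair_braid (w : W4) : W4 :=
  op4_2 r (op4_1 r (op4_3 r (op4_2 r w))).

Definition tensor_by (X : W4) (v : W2) (a b : I) : W4 :=
  [ffun j : I * I * I * I => X (a, b, j.1.1.1, j.1.1.2) * v (j.1.2, j.2) : k^o].

Lemma tensor_byE X v a b c d g h :
  tensor_by X v a b (c, d, g, h) = X (a, b, c, d) * v (g, h) :> k.
Proof. by rewrite ffunE. Qed.

Definition contract (Z : I -> I -> W4) (e f : I) : k :=
  \sum_a \sum_b Z a b (a, b, e, f).

Lemma pair_braidE w a b e f : pair_braid w (a, b, e, f) =
  \sum_s \sum_t \sum_c \sum_p \sum_u \sum_h \sum_d \sum_g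
    r b e s t * (r a s c p * (r t f u h * (r p u d g * w (c, d, g, h)))).
Proof.
rewrite /pair_braid op4_2E /act.
apply: eq_bigr => s _; apply: eq_bigr => t _; rewrite op4_1E !mulr_sumr.
apply: eq_bigr => c _; rewrite !mulr_sumr.
apply: eq_bigr => p _; rewrite op4_3E !mulr_sumr.
apply: eq_bigr => u _; rewrite !mulr_sumr.
apply: eq_bigr => h _; rewrite op4_2E !mulr_sumr.
by apply: eq_bigr => d _; rewrite !mulr_sumr.
Qed.

(** The half-dual of the braiding of V (x) V with itself is injective. It is a
    composite of four half-duals of R, which are cancelled one at a time, from
    the crossing with two free ends (Y1) to the one adjacent to X. *)
Lemma pair_braid_closed (X : W4) : closed_tensor ->
    (forall (v : W2) e f,
       contract (fun a b => pair_braid (tensor_by X v a b)) e f = 0) ->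
  X = 0.
Proof.
move=> cl X0.
pose Y3 p d b s := \sum_a \sum_c X (a, b, c, d) * r a s c p.
pose Y2 e t p d := \sum_b \sum_s Y3 p d b s * r b e s t.
pose Y1 e g t u := \sum_p \sum_d Y2 e t p d * r p u d g.
have Y10 e g t u : Y1 e g t u = 0.
  apply: cl t u => f h.
  pose v : W2 := [ffun j => (j == (g, h))%:R].
  have vE j : v j = (j == (g, h))%:R by rewrite ffunE.
  transitivity (\sum_(g' : I) \sum_(h' : I)
     (\sum_t \sum_u Y1 e g' t u * r t f u h') * v (g', h')).
    rewrite [RHS]pair_bigA [RHS](bigD1 (g, h)) //= vE eqxx mulr1.
    rewrite [X in _ + X]big1 ?addr0 // => -[g' h'] nj /=.
    by rewrite vE (negPf nj) mulr0.
  rewrite -[RHS](X0 v e f) /contract.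
  transitivity (\sum_(g' : I) \sum_(h' : I) \sum_t \sum_u \sum_p \sum_d
      \sum_b \sum_s \sum_a \sum_c
      X (a, b, c, d) * r a s c p * r b e s t * r p u d g' * r t f u h' * v (g', h')).
    do 2! (apply: eq_bigr => ? _); rewrite mulr_suml.
    apply: eq_bigr => ? _; rewrite mulr_suml.
    apply: eq_bigr => ? _; rewrite /Y1 !mulr_suml.
    apply: eq_bigr => ? _; rewrite !mulr_suml.
    apply: eq_bigr => ? _; rewrite /Y2 !mulr_suml.
    apply: eq_bigr => ? _; rewrite !mulr_suml.
    apply: eq_bigr => ? _; rewrite /Y3 !mulr_suml.
    apply: eq_bigr => ? _; rewrite !mulr_suml.
    by apply: eq_bigr.
  under [RHS]eq_bigr => a _ do under eq_bigr => b _ do rewrite pair_braidE.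
  rewrite !pair_bigA /=.
  (* Both sides are sums of the same ten-fold products; phi matches the orders
     of summation. *)
  pose phi (j : I * I * I * I * I * I * I * I * I * I) :=
    let: (a, b, s, t, c, p, u, h, d, g) := j in (g, h, t, u, p, d, b, s, a, c).
  pose psi (j : I * I * I * I * I * I * I * I * I * I) :=
    let: (g, h, t, u, p, d, b, s, a, c) := j in (a, b, s, t, c, p, u, h, d, g).
  rewrite (reindex phi) /=; last first.
    by exists psi; case=> [[[[[[[[[? ?] ?] ?] ?] ?] ?] ?] ?] ?] _.
  apply: eq_bigr; case=> [[[[[[[[[? ?] ?] ?] ?] ?] ?] ?] ?] ?] _ /=.
  rewrite tensor_byE; ring.
have Y20 e t p d : Y2 e t p d = 0.
  by apply: cl p d => u g; exact: Y10.
have Y30 p d b s : Y3 p d b s = 0.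
  by apply: cl b s => e t; exact: Y20.
apply/ffunP => -[[[a b] c] d]; rewrite fspace0.
by apply: (cl (fun a c => X (a, b, c, d))) => s p; exact: Y30.
Qed.

End Closed.

(** * The bound on the symmetric square *)

Section SymmetricSquare.

Variables (k : fieldType) (I : finType) (r : I -> I -> I -> I -> k) (x y : k).
Hypotheses (x0 : x != 0) (y0 : y != 0) (xy : x - y != 0).
Hypotheses (hr : hecke_tensor r x y) (br : braided (op3_1 r) (op3_2 r)).
Notation W2 := (fspace k (I * I)%type).
Notation W4 := (fspace k (I * I * I * I)%type).
Notation S2 := (leigenspace (op2 r) x).
Notation S3 := (sym3 (op3_1 r) (op3_2 r) x).
Notation T1 := (op4_1 r).
Notation T2 := (op4_2 r).
Notation T3 := (op4_3 r).

(** Tensors of degree 4 are cut as V^2 (x) V^2 by tens22 and as V^3 (x) V by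
   tens31. *)
Definition pair4 (ab cd : I * I) : I * I * I * I := (ab.1, ab.2, cd.1, cd.2).
Definition pair4_1 (j : I * I * I * I) : I * I := j.1.1.
Definition pair4_2 (j : I * I * I * I) : I * I := (j.1.2, j.2).

Definition tens22 (U U' : {vspace W2}) : {vspace W4} :=
  tensv pair4_1 pair4_2 U U'.

Lemma tens22P (U U' : {vspace W2}) (w : W4) :
  reflect ((forall c d, [ffun j : I * I => w (j.1, j.2, c, d)] \in U) /\
           (forall a b, [ffun j : I * I => w (a, b, j.1, j.2)] \in U'))
          (w \in tens22 U U').
Proof.
have H := @tensvP k _ _ _ pair4 pair4_1 pair4_2.
apply: (equivP (H _ _ _ U U' w)); first by case=> [[[]]].
- by case.
- by move=> ? [].
split=> -[h1 h2]; split.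
- by move=> c d; exact: (h1 (c, d)).
- by move=> a b; exact: (h2 (a, b)).
- by case=> c d; exact: h1.
- by case=> a b; exact: h2.
Qed.

Lemma dim_tens22 (U U' : {vspace W2}) : \dim (tens22 U U') = (\dim U * \dim U')%N.
Proof. by apply: (@dim_tensv k _ _ _ pair4) => [[]|? []]. Qed.

Definition tens31 (U : {vspace fspace k (I * I * I)%type}) : {vspace W4} :=
  tensv fst snd U fullv.

Lemma dim_tens31 U : \dim (tens31 U) = (\dim U * #|I|)%N.
Proof. by rewrite -(dim_fspace k I); apply: (@dim_tensv k _ _ _ pair). Qed.

Lemma tens31_sym w : w \in tens31 S3 -> T1 w = x *: w /\ T2 w = x *: w.
Proof.
case/(@tensvP _ _ _ _ pair); try by [case|].
move=> w1 _; split; apply/ffunP => -[[[a b] c] d];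
  have /sym3P[h1 h2] := w1 d; rewrite fspaceZ.
- have := congr1 (fun f : fspace k _ => f (a, b, c)) h1.
  rewrite fspaceZ op3_1E op4_1E ffunE => <-.
  by apply: eq_act => ? ?; rewrite ffunE.
- have := congr1 (fun f : fspace k _ => f (a, b, c)) h2.
  rewrite fspaceZ op3_2E op4_2E ffunE => <-.
  by apply: eq_act => ? ?; rewrite ffunE.
Qed.

Lemma tens22_sym w : T1 w = x *: w -> T3 w = x *: w -> w \in tens22 S2 S2.
Proof.
move=> w1 w3; apply/tens22P; split=> [c d|a b]; apply/mem_leigenspaceP.
  apply/ffunP => -[a b]; rewrite fspaceZ op2E ffunE /= -[RHS]fspaceZ -w1 op4_1E.
  by apply: eq_act => ? ?; rewrite ffunE.
apply/ffunP => -[c d]; rewrite fspaceZ op2E ffunE /= -[RHS]fspaceZ -w3 op4_3E.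
by apply: eq_act => ? ?; rewrite ffunE.
Qed.

Hypothesis dimS3 : (\dim S2 * \dim S2 <= \dim S3 * #|I|)%N.

(** T3 - y maps S3 (x) V injectively into S2 (x) S2, since a vector symmetric in
    places 2, 3 and killed by T3 - y is zero. By the dimension hypothesis the
    map is onto; this is how the vanishing of the symmetry type (2,2) enters. *)
Lemma sym22_lift v : v \in tens22 S2 S2 ->
  exists w, [/\ T1 w = x *: w, T2 w = x *: w & v = T3 w - y *: w].
Proof.
pose f : 'End(W4) := (T3 - y *: \1)%VF.
have fE w : f w = T3 w - y *: w.
  by rewrite add_lfunE opp_lfunE scale_lfunE id_lfunE.
have f_inj : (tens31 S3 :&: lker f = 0)%VS.
  apply/eqP; rewrite -subv0; apply/subvP => w.
  rewrite memv_cap memv0 memv_ker fE subr_eq0.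
  move=> /andP[/tens31_sym[_ w2] /eqP w3]; apply/eqP.
  exact: (eigen_mixed0 (op4_braid23 br) x0 y0 xy w2 w3).
have sub : (f @: tens31 S3 <= tens22 S2 S2)%VS.
  apply/subvP => _ /memv_imgP[w /tens31_sym[w1 w2] ->]; rewrite fE.
  apply: tens22_sym; last exact: (sub_eigenvector (op4_3_quadratic hr)).
  by rewrite lfunD lfunN op4_comm13 lfunZ w1 lfunZ; lin_comb.
have /eqP <- : (f @: tens31 S3 == tens22 S2 S2)%VS.
  rewrite eqEdim sub dim_tens22 (leq_trans dimS3) //.
  by rewrite limg_dim_eq // dim_tens31.
case/memv_imgP => w /tens31_sym[w1 w2] ->.
by exists w; rewrite -fE.
Qed.

Lemma sym22_pair_braiding v : v \in tens22 S2 S2 ->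
  let u := T3 (T2 v) - y *: T2 v in
  (x - y) *: pair_braid r v =
    x ^+ 2 *: (T1 u - y *: u) + (x ^+ 3 * y * (x - y)) *: v.
Proof.
case/sym22_lift => w [w1 w2 ->].
apply: pair_braiding w1 w2; [exact: op4_braid12|exact: op4_braid23|
  exact: op4_comm13|exact: op4_3_quadratic].
Qed.

(** A family Z a b of tensors is an element of (V (x) V)^* (x) V^4; contract
    evaluates its functional part on the first two places. The functional part
    satisfies phi R = x phi exactly when left_eigen holds. *)
Section Contraction.

Implicit Types Z : I -> I -> W4.

Definition left_eigen Z := forall c d,
  \sum_a \sum_b r a b c d *: Z a b = x *: Z c d.

Lemma eq_left_eigen Z Z' :
  (forall a b, Z a b = Z' a b) -> left_eigen Z -> left_eigen Z'.
Proof.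
move=> ZZ' Zx c d; rewrite -ZZ' -Zx.
by apply: eq_bigr => a _; apply: eq_bigr => b _; rewrite ZZ'.
Qed.

Lemma left_eigen_comp (T : 'End(W4)) Z :
  left_eigen Z -> left_eigen (fun a b => T (Z a b)).
Proof.
move=> Zx c d; rewrite -lfunZ -Zx linear_sum; apply: eq_bigr => a _.
by rewrite linear_sum; apply: eq_bigr => b _ /=; rewrite lfunZ.
Qed.

Lemma contract_op1 Z e f : left_eigen Z ->
  contract (fun a b => T1 (Z a b)) e f = x * contract Z e f.
Proof.
move=> Zx; rewrite /contract mulr_sumr.
transitivity (\sum_a \sum_b \sum_c \sum_d r a b c d * Z a b (c, d, e, f)).
  by apply: eq_bigr => a _; apply: eq_bigr => b _; rewrite op4_1E.
under eq_bigr => a _ do rewrite exchange_big.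
rewrite exchange_big; apply: eq_bigr => c _ /=.
under eq_bigr => a _ do rewrite exchange_big.
rewrite exchange_big mulr_sumr; apply: eq_bigr => d _ /=.
rewrite -[RHS]fspaceZ -Zx fspace_sum; apply: eq_bigr => a _.
by rewrite fspace_sum; apply: eq_bigr => b _; rewrite fspaceZ.
Qed.

Lemma contract_op3 Z e f :
  contract (fun a b => T3 (Z a b)) e f = act r (contract Z) e f.
Proof.
rewrite /contract /act.
transitivity (\sum_a \sum_b \sum_c \sum_d r e f c d * Z a b (a, b, c, d)).
  by apply: eq_bigr => a _; apply: eq_bigr => b _; rewrite op4_3E.
under eq_bigr => a _ do rewrite exchange_big.
rewrite exchange_big; apply: eq_bigr => c _ /=.
under eq_bigr => a _ do rewrite exchange_big.
rewrite exchange_big; apply: eq_bigr => d _ /=.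
rewrite mulr_sumr; apply: eq_bigr => a _.
by rewrite mulr_sumr.
Qed.

Lemma contractB Z Z' c e f :
  contract (fun a b => Z a b - c *: Z' a b) e f =
    contract Z e f - c * contract Z' e f.
Proof.
rewrite /contract mulr_sumr -sumrB; apply: eq_bigr => a _.
rewrite mulr_sumr -sumrB; apply: eq_bigr => b _.
by rewrite fspaceD fspaceN fspaceZ.
Qed.

End Contraction.

(** Here X lies in Phi (x) S2, where Phi is the space of functionals phi on
    V (x) V with phi R = x phi, and its partial trace, an element of V^* (x) V,
    vanishes. *)
Section TraceFree.

Variable X : W4.
Hypothesis Xl : forall v, left_eigen (tensor_by X v).
Hypothesis Xr : forall a b, [ffun j : I * I => X (a, b, j.1, j.2)] \in S2.
Hypothesis Xtr : forall b d, \sum_a X (a, b, a, d) = 0.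

Lemma contract_tensor v e f : contract (tensor_by X v) e f = 0.
Proof.
rewrite /contract exchange_big big1 // => b _ /=.
transitivity ((\sum_a X (a, b, a, b)) * v (e, f)).
  by rewrite mulr_suml; apply: eq_bigr => a _; rewrite tensor_byE.
by rewrite Xtr mul0r.
Qed.

Lemma contract_op2 v e f :
  contract (fun a b => T2 (tensor_by X v a b)) e f = 0.
Proof.
transitivity (\sum_b \sum_d \sum_g
   r b e d g * (\sum_a X (a, b, a, d)) * v (g, f)).
  rewrite /contract exchange_big; apply: eq_bigr => b _ /=.
  transitivity (\sum_a \sum_d \sum_g
    r b e d g * (X (a, b, a, d) * v (g, f))).
    apply: eq_bigr => a _; rewrite op4_2E; apply: eq_bigr => d _.
    by apply: eq_bigr => g _; rewrite tensor_byE.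
  rewrite exchange_big; apply: eq_bigr => d _ /=.
  rewrite exchange_big; apply: eq_bigr => g _ /=.
  rewrite mulr_sumr mulr_suml; apply: eq_bigr => a _; exact: mulrA.
rewrite big1 // => b _; rewrite big1 // => d _; rewrite big1 // => g _.
by rewrite Xtr mulr0 mul0r.
Qed.

(** By sym22_pair_braiding the braiding is a combination of the identity and of
    the symmetrization of T2, whose contractions with X only involve the
    partial trace of X. *)
Lemma contract_braid_sym v e f : v \in S2 ->
  contract (fun a b => pair_braid r (tensor_by X v a b)) e f = 0.
Proof.
move=> vS; pose Z a b := T3 (T2 (tensor_by X v a b)) - y *: T2 (tensor_by X v a b).
have Z0 e' f' : contract Z e' f' = 0.
  rewrite contractB contract_op3 contract_op2 mulr0 subr0 /act.
  rewrite big1 // => c _; rewrite big1 // => d _.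
  by rewrite contract_op2 mulr0.
have Zx : left_eigen Z.
  apply: (@eq_left_eigen (fun a b => ((T3 - y *: \1) \o T2)%VF (tensor_by X v a b))).
    move=> a b; rewrite comp_lfunE.
    by rewrite add_lfunE opp_lfunE scale_lfunE id_lfunE.
  exact: left_eigen_comp.
apply/eqP; have : (x - y) * contract (fun a b => pair_braid r (tensor_by X v a b)) e f == 0.
  apply/eqP.
  transitivity (x ^+ 2 * (contract (fun a b => T1 (Z a b)) e f - y * contract Z e f)
      + (x ^+ 3 * y * (x - y)) * contract (tensor_by X v) e f).
    rewrite -contractB /contract !mulr_sumr -big_split; apply: eq_bigr => a _ /=.
    rewrite !mulr_sumr -big_split; apply: eq_bigr => b _ /=.
    rewrite -fspaceZ sym22_pair_braiding; first by rewrite !(fspaceD, fspaceZ).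
    apply/tens22P; split=> [g h|c d].
      have -> : [ffun j : I * I => tensor_by X v a b (j.1, j.2, g, h)] =
          v (g, h) *: ([ffun j : I * I => X (a, b, j.1, j.2)] : W2).
        by apply/ffunP => -[c d]; rewrite fspaceZ !ffunE mulrC.
      exact: memvZ.
    have -> : [ffun j : I * I => tensor_by X v a b (c, d, j.1, j.2)] =
        X (a, b, c, d) *: v.
      by apply/ffunP => -[g h]; rewrite fspaceZ !ffunE.
    exact: memvZ.
  by rewrite contract_op1 // Z0 contract_tensor !mulr0 subr0 mulr0 addr0.
by rewrite mulf_eq0 (negPf xy).
Qed.

(** Since phi R = x phi, replacing v by (R - y) v, which is symmetric,
    multiplies the contraction by x - y. *)
Lemma contract_braid v e f :
  contract (fun a b => pair_braid r (tensor_by X v a b)) e f = 0.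
Proof.
pose w := op2 r v - y *: v.
have wS : w \in S2.
  by apply/mem_leigenspaceP/sub_eigenvector/(op2_quadratic hr).
have BT3 z : pair_braid r (T3 z) = T1 (pair_braid r z).
  by rewrite /pair_braid -(op4_braid23 br) -(op4_braid12 br).
apply/eqP; have : (x - y) * contract (fun a b => pair_braid r (tensor_by X v a b)) e f == 0.
  apply/eqP; rewrite -[RHS](contract_braid_sym e f wS) mulrBl.
  rewrite -contract_op1; last first.
    apply: (@eq_left_eigen (fun a b => (T2 \o T1 \o T3 \o T2)%VF (tensor_by X v a b))).
      by move=> a b; rewrite !comp_lfunE.
    exact: left_eigen_comp.
  rewrite -contractB; apply: eq_bigr => a _; apply: eq_bigr => b _.
  have -> : tensor_by X w a b = T3 (tensor_by X v a b) - y *: tensor_by X v a b.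
    apply/ffunP => -[[[c d] g] h].
    rewrite fspaceD fspaceN fspaceZ op4_3E !tensor_byE /w.
    rewrite fspaceD fspaceN fspaceZ op2E mulrBr mulrCA; congr (_ - _).
    rewrite /act mulr_sumr; apply: eq_bigr => i _; rewrite mulr_sumr.
    by apply: eq_bigr => j _; rewrite tensor_byE mulrCA.
  by rewrite -BT3 /pair_braid !lfun_lin.
by rewrite mulf_eq0 (negPf xy).
Qed.

End TraceFree.

(** The partial trace sends Phi (x) S2, of dimension at least (dim S2)^2, to the
    space V^* (x) V of dimension (dim V)^2. If dim S2 > dim V, some nonzero X
    has zero partial trace, and the half-dual of the pair braiding kills it. *)
Lemma dim_sym2_le : closed_tensor r -> (\dim S2 <= #|I|)%N.
Proof.
move=> cl; case: leqP => // big.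
pose rt a b c d := r c d a b.
pose Phi := leigenspace (op2 rt) x.
have dPhi : (\dim S2 <= \dim Phi)%N.
  apply: leigenspace_adjoint => f g; rewrite /pairing.
  transitivity (\sum_i \sum_j \sum_c \sum_d r c d i j * f (c, d) * g (i, j)).
    rewrite [RHS]pair_bigA; apply: eq_bigr => -[i j] _.
    rewrite op2E mulr_suml; apply: eq_bigr => c _.
    by rewrite mulr_suml.
  transitivity (\sum_c \sum_d \sum_i \sum_j r c d i j * f (c, d) * g (i, j)).
    under eq_bigr => i _ do rewrite exchange_big.
    rewrite exchange_big; apply: eq_bigr => c _ /=.
    under eq_bigr => i _ do rewrite exchange_big.
    exact: exchange_big.
  rewrite [LHS]pair_bigA; apply: eq_bigr => -[c d] _.
  rewrite op2E mulr_sumr; apply: eq_bigr => i _.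
  by rewrite mulr_sumr; apply: eq_bigr => j _; rewrite mulrAC mulrC.
pose E_fun (X : W4) : W2 := [ffun j : I * I => \sum_a X (a, j.1, a, j.2)].
have E_lin : linear E_fun.
  move=> c X Y; apply/ffunP => j; rewrite fspaceD fspaceZ !ffunE.
  rewrite mulr_sumr -big_split; apply: eq_bigr => a _.
  by rewrite fspaceD fspaceZ.
pose E := lin_hom E_lin.
have : (0 < \dim (tens22 Phi S2 :&: lker E))%N.
  have := limg_ker_dim E (tens22 Phi S2); rewrite dim_tens22.
  have : (\dim (E @: tens22 Phi S2) <= #|I| * #|I|)%N.
    by rewrite -card_prod -(dim_fspace k) dimvS ?subvf.
  nia.
rewrite lt0n dimv_eq0 -subv0 => /subvPn[X]; rewrite memv_cap memv_ker memv0.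
case/andP => /tens22P[XPhi XS] /eqP EX; apply: contraNT => _; apply/eqP.
apply: (pair_braid_closed cl) => v e f; apply: contract_braid => // [u c d|b d].
  apply/ffunP => -[[[c' d'] g] h]; rewrite fspaceZ tensor_byE fspace_sum.
  have /mem_leigenspaceP := XPhi c' d'.
  move/(congr1 (fun w : W2 => w (c, d))); rewrite op2E fspaceZ !ffunE /= => e'.
  rewrite mulrA -e' mulr_suml; apply: eq_bigr => a _.
  rewrite fspace_sum mulr_suml; apply: eq_bigr => b _.
  by rewrite fspaceZ tensor_byE ffunE mulrA.
have := congr1 (fun w : W2 => w (b, d)) EX.
by rewrite lin_homE ffunE fspace0.
Qed.

End SymmetricSquare.

(** * The bound on the dimension *)

(** With s2, s3 and l2, l3 the dimensions of the symmetric and antisymmetric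
    powers, sym3_dim_le transfers the hypothesis of card_le2 from the former to
    the latter. *)
Lemma sym_square_transfer (n s2 l2 s3 l3 s21 l21 : nat) :
  (s2 + l2 = n * n -> s21 = s2 * n -> l21 = l2 * n ->
   l21 + s3 <= s21 + l3 -> s2 * s2 <= s3 * n -> l2 * l2 <= l3 * n)%N.
Proof.
move=> nn -> -> le3 s22.
have : (l2 * (s2 + l2) + s3 * n <= s2 * (s2 + l2) + l3 * n)%N.
  by rewrite nn !mulnA -!mulnDl leq_mul2r le3 orbT.
by rewrite !mulnDr; lia.
Qed.

Lemma square_le_double (n s2 l2 : nat) :
  (s2 + l2 = n * n -> s2 <= n -> l2 <= n -> n <= 2)%N.
Proof.
move=> nn s2n l2n; rewrite leqNgt; apply/negP => lt2.
have : (n * n <= 2 * n)%N by rewrite -nn mul2n -addnn leq_add.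
rewrite leq_pmul2r; last exact: ltn_trans lt2.
by rewrite leqNgt lt2.
Qed.

Section DimensionBound.

Variables (k : fieldType) (I : finType) (r : I -> I -> I -> I -> k).

Lemma dim_eigen_op3_1 x :
  \dim (leigenspace (op3_1 r) x) = (\dim (leigenspace (op2 r) x) * #|I|)%N.
Proof.
rewrite -(dim_fspace k I).
rewrite -(@dim_tensv k _ _ _ pair fst snd) //; congr (\dim _).
apply/vspaceP => w; apply/mem_leigenspaceP/(@tensvP _ _ _ _ pair) => //.
- by case.
- move=> wx; split=> [c|? //]; last exact: memvf.
  apply/mem_leigenspaceP/ffunP => -[a b]; rewrite fspaceZ op2E ffunE /=.
  rewrite -[RHS]fspaceZ -wx op3_1E.
  by apply: eq_act => ? ?; rewrite ffunE.
case=> h _; apply/ffunP => -[[a b] c]; rewrite fspaceZ op3_1E.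
have /mem_leigenspaceP/(congr1 (fun f : fspace k _ => f (a, b))) := h c.
rewrite op2E fspaceZ ffunE => <-.
by apply: eq_act => ? ?; rewrite ffunE.
Qed.

Variables x y : k.
Hypotheses (x0 : x != 0) (y0 : y != 0) (xy : x - y != 0).
Hypothesis q3 : x ^+ 2 - x * y + y ^+ 2 != 0.
Hypotheses (hr : hecke_tensor r x y) (br : braided (op3_1 r) (op3_2 r)).
Hypothesis cl : closed_tensor r.

(** Both eigenspaces of r in degree 2 have dimension at most #|I| by
    dim_sym2_le, and their dimensions add up to #|I|^2. *)
Lemma card_le2 :
  (\dim (leigenspace (op2 r) x) * \dim (leigenspace (op2 r) x)
     <= \dim (sym3 (op3_1 r) (op3_2 r) x) * #|I|)%N -> (#|I| <= 2)%N.
Proof.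
move=> bx.
have hr' : hecke_tensor r y x.
  by move=> f a b; rewrite hr (addrC y) (mulrC y).
have yx : y - x != 0 by rewrite -opprB oppr_eq0.
have dI : (\dim (leigenspace (op2 r) x) + \dim (leigenspace (op2 r) y) =
           #|I| * #|I|)%N.
  by rewrite (leigenspace_dimD (op2_quadratic hr) xy) dim_fspace card_prod.
have le3 := sym3_dim_le br x0 y0 xy (op3_1_quadratic hr) (op3_2_quadratic hr) q3.
have by_ := sym_square_transfer dI (dim_eigen_op3_1 x) (dim_eigen_op3_1 y) le3 bx.
apply: (square_le_double dI); first exact: dim_sym2_le hr br bx cl.
exact: dim_sym2_le hr' br by_ cl.
Qed.

End DimensionBound.

(** * Coordinates of a Hecke symmetry *)

Section PureTensors.

Variables (k : fieldType) (V W : vectType k).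

Lemma pureZl a (v : V) (w : W) : pure (a *: v) w = a *: pure v w.
Proof. by rewrite -!(lin_homE (pure_linl w)) lfunZ. Qed.

Lemma pureZr a (v : V) (w : W) : pure v (a *: w) = a *: pure v w.
Proof. by rewrite -!(lin_homE (pure_linr v)) lfunZ. Qed.

Lemma pure_suml (T : Type) (s : seq T) (F : T -> V) (w : W) :
  pure (\sum_(t <- s) F t) w = \sum_(t <- s) pure (F t) w.
Proof.
rewrite -(lin_homE (pure_linl w)) linear_sum.
by apply: eq_bigr => t _; rewrite /= lin_homE.
Qed.

Lemma pure_sumr (T : Type) (s : seq T) (v : V) (F : T -> W) :
  pure v (\sum_(t <- s) F t) = \sum_(t <- s) pure v (F t).
Proof.
rewrite -(lin_homE (pure_linr v)) linear_sum.
by apply: eq_bigr => t _; rewrite /= lin_homE.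
Qed.

Lemma crd_inj (v : V) : (forall i, crd i v = 0) -> v = 0.
Proof. by move=> v0; rewrite (crd_bas v) big1 // => i _; rewrite v0 scale0r. Qed.

Lemma pure_bas_free (F : 'I_(\dim {:W}) -> V) :
  \sum_j pure (F j) (bas j) = 0 -> forall j, F j = 0.
Proof.
move=> F0 j; apply: crd_inj => i.
have := congr1 (fun M : 'M[k]_(_, _) => M i j) F0.
rewrite summxE mxE (bigD1 j) //= big1 => [|l lj].
  by rewrite mxE crd_basE eqxx mulr1 addr0.
by rewrite mxE crd_basE eq_sym (negPf lj) mulr0.
Qed.

End PureTensors.

Section Coordinates.

Variables (k : fieldType) (V : vectType k) (q : k) (R : 'End(V \ox V)).
Notation I := 'I_(\dim {:V}).

Definition rcoef (a b c d : I) : k :=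
  (R (pure (bas c) (bas d)) : 'M[k]_(_, _)) a b.

Lemma R_bas c d :
  R (pure (bas c) (bas d)) = \sum_a \sum_b rcoef a b c d *: pure (bas a) (bas b).
Proof. exact: tens_sum. Qed.

Definition tens2 (f : fspace k (I * I)%type) : V \ox V :=
  \matrix_(a, b) f (a, b).

Lemma tens2E f : tens2 f = \sum_a \sum_b f (a, b) *: pure (bas a) (bas b).
Proof.
rewrite [LHS]tens_sum; apply: eq_bigr => a _; apply: eq_bigr => b _.
by rewrite mxE.
Qed.

Lemma R_tens2 f : R (tens2 f) = tens2 (op2 rcoef f).
Proof.
rewrite tens2E linear_sum.
apply/matrixP => a b; rewrite mxE op2E summxE; apply: eq_bigr => c _.
rewrite linear_sum summxE; apply: eq_bigr => d _.
by rewrite linearZ /= mxE mulrC.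
Qed.

Lemma rcoef_hecke : hecke_equation q R -> hecke_tensor rcoef q (-1).
Proof.
move=> hR f a b.
pose w : fspace k (I * I)%type := [ffun j : I * I => f j.1 j.2].
have actw a' b' : op2 rcoef w (a', b') = act rcoef f a' b'.
  by rewrite op2E; apply: eq_act => ? ?; rewrite ffunE.
have := congr1 (fun g : 'End(V \ox V) => (g (tens2 w) : 'M[k]_(_, _)) a b) hR.
rewrite zero_lfunE comp_lfunE !(add_lfunE, opp_lfunE, scale_lfunE, id_lfunE).
rewrite !lfun_lin !R_tens2 !mxE op2E actw ffunE /=.
rewrite (eq_act (g := act rcoef f) _ _ _ actw) => e.
apply/eqP; rewrite -subr_eq0 -e; apply/eqP; ring.
Qed.

Definition last_slice (w : fspace k (I * I * I)%type) (c : I) :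
  fspace k (I * I)%type := [ffun j : I * I => w (j, c)].

Definition tens3 (w : fspace k (I * I * I)%type) : V \ox V \ox V :=
  \sum_c pure (tens2 (last_slice w c)) (bas c).

Lemma tens3_inj w w' : tens3 w = tens3 w' -> w = w'.
Proof.
move/eqP; rewrite -subr_eq0 /tens3 -sumrB => /eqP e.
have : \sum_c pure (tens2 (last_slice w c) - tens2 (last_slice w' c)) (bas c) = 0.
  rewrite -[RHS]e; apply: eq_bigr => c _.
  by rewrite -!(lin_homE (pure_linl (bas c))) lfunD lfunN.
move/pure_bas_free => {}e; apply/ffunP => -[[a b] c].
have /eqP := e c; rewrite subr_eq0 => /eqP.
move/(congr1 (fun M : 'M[k]_(_, _) => M a b)).
by rewrite !mxE !ffunE.
Qed.

Lemma R12_tens3 w : R12 R (tens3 w) = tens3 (op3_1 rcoef w).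
Proof.
rewrite /tens3 linear_sum; apply: eq_bigr => c _.
rewrite /= tmapE id_lfunE R_tens2; congr (pure (tens2 _) _).
apply/ffunP => -[a b]; rewrite op2E ffunE op3_1E.
by apply: eq_act => ? ?; rewrite ffunE.
Qed.

Lemma tens3E w : tens3 w =
  \sum_a \sum_b \sum_c w (a, b, c) *: pure (pure (bas a) (bas b)) (bas c).
Proof.
transitivity (\sum_c \sum_a \sum_b
    w (a, b, c) *: pure (pure (bas a) (bas b) : V \ox V) (bas c)).
  apply: eq_bigr => c _; rewrite tens2E pure_suml; apply: eq_bigr => a _.
  by rewrite pure_suml; apply: eq_bigr => b _; rewrite pureZl ffunE.
rewrite exchange_big; apply: eq_bigr => a _; exact: exchange_big.
Qed.

Lemma R23_tens3 w : R23 R (tens3 w) = tens3 (op3_2 rcoef w).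
Proof.
rewrite !tens3E linear_sum; apply: eq_bigr => a _ /=.
transitivity (\sum_b \sum_c \sum_b' \sum_c'
    (rcoef b' c' b c * w (a, b, c)) *: pure (pure (bas a) (bas b') : V \ox V) (bas c')).
  rewrite linear_sum; apply: eq_bigr => b _ /=.
  rewrite linear_sum; apply: eq_bigr => c _ /=.
  rewrite lfunZ /R23 !comp_lfunE tassocE tmapE id_lfunE R_bas.
  rewrite pure_sumr linear_sum scaler_sumr; apply: eq_bigr => b' _ /=.
  rewrite pure_sumr linear_sum scaler_sumr; apply: eq_bigr => c' _ /=.
  by rewrite pureZr lfunZ tassocVE scalerA mulrC.
under [LHS]eq_bigr => b _ do rewrite exchange_big.
rewrite [LHS]exchange_big; apply: eq_bigr => b' _ /=.
under [LHS]eq_bigr => b _ do rewrite exchange_big.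
rewrite [LHS]exchange_big; apply: eq_bigr => c' _ /=.
rewrite op3_2E /act scaler_suml; apply: eq_bigr => b _.
by rewrite scaler_suml.
Qed.

Lemma rcoef_braided : yang_baxter R -> braided (op3_1 rcoef) (op3_2 rcoef).
Proof.
move: R12_tens3 R23_tens3; rewrite /yang_baxter.
move: (R12 R) (R23 R) => A B AE BE yb w; apply: tens3_inj.
have := congr1 (fun g : 'End(V \ox V \ox V) => g (tens3 w)) yb.
by rewrite !comp_lfunE !(AE, BE).
Qed.

Definition dbas (a : I) : dual V := linfun (@crd k V a).

Lemma dbasE a (v : V) : (dbas a : 'Hom(V, k^o)) v = crd a v.
Proof. by rewrite lfunE. Qed.

Lemma linfun_linE (U W : vectType k) (f : U -> W) (fl : linear f) u :
  linfun f u = f u.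
Proof. exact: lin_homE fl u. Qed.

Lemma db_one : db V (1 : k^o) = \sum_g pure (bas g) (dbas g).
Proof.
rewrite linfun_linE ?scale1r // => c a b.
by rewrite scalerDl scalerA.
Qed.

(** The part of the half-dual operator that follows R. *)
Lemma ev_contract (phi d : dual V) (v w : V) :
  tunitl (V \ox dual V) (tmap (ev V) \1%VF (tassocV (dual V) V (V \ox dual V)
    (tmap \1%VF (tassoc V V (dual V)) (pure phi (pure (pure v w) d))))) =
  ((phi : 'Hom(V, k^o)) v : k) *: pure w d.
Proof.
rewrite tmapE id_lfunE tassocE tassocVE tmapE id_lfunE tunitlE /ev tliftE //.
split=> [v' a f g|f a v' w']; last exact: linearP.
by rewrite add_lfunE scale_lfunE.
Qed.

Lemma half_dual_bas a c :
  half_dual R (pure (dbas a) (bas c)) =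
    \sum_e \sum_g rcoef a e c g *: pure (bas e) (dbas g).
Proof.
rewrite /half_dual !comp_lfunE (linfun_linE (pure_linl (1 : k^o))).
rewrite tmapE id_lfunE db_one pure_sumr !linear_sum /=.
rewrite [RHS]exchange_big; apply: eq_bigr => g _.
rewrite tassocE tmapE id_lfunE tassocVE tmapE id_lfunE (tmapE R) id_lfunE R_bas.
rewrite pure_suml pure_sumr !linear_sum (bigD1 a) //= [X in _ + X]big1 ?addr0.
  rewrite pure_suml pure_sumr !linear_sum; apply: eq_bigr => e _ /=.
  rewrite pureZl pureZr !lfunZ ev_contract dbasE crd_basE eqxx.
  by rewrite scale1r.
move=> i ia; rewrite pure_suml pure_sumr !linear_sum big1 // => e _ /=.
rewrite pureZl pureZr !lfunZ ev_contract dbasE crd_basE eq_sym (negPf ia).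
by rewrite scale0r scaler0.
Qed.

Lemma rcoef_closed : injective (half_dual R) -> closed_tensor rcoef.
Proof.
move=> inj Y Y0 a c.
have : \sum_c pure (\sum_a Y a c *: dbas a) (bas c) = 0.
  apply: inj; rewrite linear0 linear_sum.
  transitivity (\sum_e \sum_g (\sum_a \sum_c Y a c * rcoef a e c g) *: pure (bas e) (dbas g)).
    transitivity (\sum_c \sum_a \sum_e \sum_g (Y a c * rcoef a e c g) *: pure (bas e) (dbas g)).
      apply: eq_bigr => c' _; rewrite pure_suml linear_sum.
      apply: eq_bigr => a' _; rewrite /= pureZl lfunZ half_dual_bas scaler_sumr.
      apply: eq_bigr => e _; rewrite scaler_sumr; apply: eq_bigr => g _.
      by rewrite scalerA.
    rewrite exchange_big /=.
    under eq_bigr => c' _ do rewrite exchange_big.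
    rewrite exchange_big; apply: eq_bigr => e _ /=.
    under eq_bigr => c' _ do rewrite exchange_big.
    rewrite exchange_big; apply: eq_bigr => g _ /=.
    by rewrite scaler_suml; apply: eq_bigr => b _; rewrite scaler_suml.
  rewrite big1 // => e _; rewrite big1 // => g _.
  by rewrite Y0 scale0r.
move/pure_bas_free => /(_ c) /(congr1 (fun f : dual V => (f : 'Hom(V, k^o)) (bas a))).
rewrite zero_lfunE sum_lfunE (bigD1 a) //= big1 => [|b ba].
  by rewrite scale_lfunE dbasE crd_basE eqxx addr0 => e; rewrite -[LHS]mulr1.
by rewrite scale_lfunE dbasE crd_basE (negPf ba) scaler0.
Qed.

End Coordinates.

(** * Graded components of a quotient of the tensor algebra *)

Section GradedComponents.

Variables (k : fieldType) (V : vectType k).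
Notation I := 'I_(\dim {:V}).
Notation A := (tensor_algebra V).

Definition monomial (m : {fmonom I}) : A := mkmalgU m 1.

Lemma mcoeff_scale (c : k) (x : A) m : mcoeff m (c *: x) = c * mcoeff m x.
Proof. exact: mcoeffZ. Qed.

Lemma letterM_monomial i m : letter i * monomial m = monomial (mmul (fmu i) m).
Proof. by rewrite [LHS]malgM_def fgmulUU mulr1. Qed.

(** The component of degree n, with its monomials enumerated by J. *)
Section Component.

Variables (n : nat) (J : finType) (word : J -> {fmonom I}).
Hypotheses (word_inj : injective word) (word_deg : forall j, fdeg (word j) = n).
Hypothesis word_surj : forall m, fdeg m = n -> exists j, word j = m.

Definition of_coefs (f : fspace k J) : A := \sum_j f j *: monomial (word j).
Definition coefs_fun (x : A) : fspace k J := [ffun j : J => (mcoeff (word j) x : k^o)].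

Lemma mcoeff_of_coefs f m :
  mcoeff m (of_coefs f) = \sum_j f j * (word j == m)%:R.
Proof.
rewrite raddf_sum; apply: eq_bigr => j _.
by rewrite /= mcoeff_scale mcoeffU1.
Qed.

Lemma of_coefs_homog f : homogeneous n (of_coefs f).
Proof.
move=> m; rewrite -mcoeff_neq0 mcoeff_of_coefs => nz.
apply/eqP; apply: contraNT nz => nm; apply/eqP; apply: big1 => j _.
case: eqP => [e|]; last by rewrite mulr0.
by rewrite -e word_deg eqxx in nm.
Qed.

Lemma of_coefsK f : coefs_fun (of_coefs f) = f.
Proof.
apply/ffunP => j; rewrite ffunE mcoeff_of_coefs (bigD1 j) //= eqxx mulr1.
by rewrite big1 ?addr0 // => i ij; rewrite (inj_eq word_inj) (negPf ij) mulr0.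
Qed.

Lemma coefsK x : homogeneous n x -> of_coefs (coefs_fun x) = x.
Proof.
move=> hx; apply/malgP => m.
have [/word_surj[j <-]|nm] := eqVneq (fdeg m) n.
  by have := congr1 (fun f : fspace k J => f j) (of_coefsK (coefs_fun x)); rewrite !ffunE.
rewrite mcoeff_of_coefs big1 => [|j _].
  by apply/esym/eqP; rewrite mcoeff_eq0; apply: contraNN nm => /hx ->.
by case: eqP => [e|]; [rewrite -e word_deg eqxx in nm|rewrite mulr0].
Qed.

Lemma coefs_linear : linear coefs_fun.
Proof.
move=> a x z; apply/ffunP => j; rewrite fspaceD fspaceZ !ffunE.
by rewrite mcoeffD mcoeff_scale.
Qed.

Lemma of_coefs_linear : linear of_coefs.
Proof.
move=> a f g; rewrite /of_coefs scaler_sumr -big_split; apply: eq_bigr => j _.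
by rewrite /= fspaceD fspaceZ scalerDl scalerA.
Qed.

Section QuotientDimension.

Variables (Id : A -> Prop) (m : nat) (N : {vspace fspace k J}).
Hypothesis Id_ideal : two_sided_ideal Id.
Hypothesis dimU : dim_mod (homogeneous n) Id m.

(** The m classes are independent modulo the ideal, hence modulo any N whose
    elements lie in the ideal. *)
Lemma dim_mod_add_le :
  (forall f, f \in N -> Id (of_coefs f)) -> (m + \dim N <= #|J|)%N.
Proof.
case: dimU => e he uniq NId; case: Id_ideal => Id0 IdD _ _.
have free_e (c : {ffun 'I_m -> k}) : Id (\sum_i c i *: e i) -> c = 0.
  move=> Idc; have h0 : homogeneous n (0 : A) by move=> w; rewrite msupp0.
  have [c0 [_ c0u]] := uniq 0 h0.
  have c00 : c0 = 0.
    apply: c0u; rewrite big1 ?subr0 // => i _.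
    by rewrite ffunE scale0r.
  apply: oppr_inj; rewrite oppr0 -c00; apply/esym/c0u.
  rewrite sub0r -sumrN; have -> // : \sum_i - ((- c) i *: e i) = \sum_i c i *: e i.
  by apply: eq_bigr => i _; rewrite ffunE scaleNr opprK.
pose g_fun (c : fspace k 'I_m) : fspace k J := \sum_i c i *: coefs_fun (e i).
have g_lin : linear g_fun.
  move=> a c d; rewrite /g_fun scaler_sumr -big_split; apply: eq_bigr => i _ /=.
  by rewrite fspaceD fspaceZ scalerDl scalerA.
pose g := lin_hom g_lin.
have gE c : of_coefs (g c) = \sum_i c i *: e i.
  rewrite lin_homE /g_fun.
  elim/big_rec2: _ => [|i u v _ <-]; first by rewrite /of_coefs big1 // => j _; rewrite fspace0 scale0r.
  by rewrite of_coefs_linear coefsK.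
have gN c : g c \in N -> c = 0.
  by move=> gc; apply: free_e; rewrite -gE; apply: NId.
have dg : \dim (limg g) = m.
  rewrite limg_dim_eq ?dim_fspace ?card_ord //.
  apply/eqP; rewrite -subv0; apply/subvP => c; rewrite memv_cap memv_ker memv0.
  by move=> /andP[_ /eqP gc]; apply/eqP/gN; rewrite gc mem0v.
have disj : (limg g :&: N = 0)%VS.
  apply/eqP; rewrite -subv0; apply/subvP => w; rewrite memv_cap memv0.
  by case/andP=> /memv_imgP[c _ ->] /gN ->; rewrite linear0.
have eN := dimv_disjoint_sum disj.
rewrite -(dim_fspace k J); apply: leq_trans (dimvS (subvf (limg g + N)%VS)).
by rewrite eN leq_add2r (eq_leq (esym dg)).
Qed.

(** The m classes span modulo the ideal, hence modulo any N that contains the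
    degree n part of the ideal. *)
Lemma dim_mod_add_ge :
  (forall x, Id x -> coefs_fun x \in N) -> (#|J| <= m + \dim N)%N.
Proof.
case: dimU => e he uniq IdN.
pose g_fun (c : fspace k 'I_m) : fspace k J := \sum_i c i *: coefs_fun (e i).
have g_lin : linear g_fun.
  move=> a c d; rewrite /g_fun scaler_sumr -big_split; apply: eq_bigr => i _ /=.
  by rewrite fspaceD fspaceZ scalerDl scalerA.
pose g := lin_hom g_lin.
have cover : (limg g + N = fullv)%VS.
  apply/vspaceP => f; rewrite memvf.
  have [c [cId _]] := uniq _ (@of_coefs_homog f).
  have := IdN _ cId.
  have -> : coefs_fun (of_coefs f - \sum_i c i *: e i) = f - g c.
    rewrite lin_homE -[in RHS](of_coefsK f); apply/ffunP => j.
    rewrite fspaceD fspaceN fspace_sum !ffunE mcoeffB; congr (_ - _); rewrite raddf_sum.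
    by apply: eq_bigr => i _; rewrite fspaceZ ffunE /= mcoeff_scale.
  move=> fN; rewrite -(subrK (g c) f) addrC.
  by apply: memv_add fN; rewrite memv_img ?memvf.
have dg : (\dim (limg g) <= m)%N.
  by rewrite -[leqRHS]card_ord -(dim_fspace k) -(limg_ker_dim g fullv) leq_addl.
rewrite -(dim_fspace k) -cover (@leq_trans (\dim (limg g) + \dim N)) ?leq_add2r //.
by rewrite -dimv_sum_cap leq_addr.
Qed.

End QuotientDimension.
End Component.
End GradedComponents.

(** * Quantum symmetric powers of degree at most three *)

Section LowDegrees.

Variables (k : fieldType) (V : vectType k) (q : k) (R : 'End(V \ox V)).
Notation I := 'I_(\dim {:V}).
Notation A := (tensor_algebra V).
Notation r := (rcoef R).

Definition word1 (i : I) : {fmonom I} := fmu i.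
Definition word2 (j : I * I) : {fmonom I} := mmul (fmu j.1) (fmu j.2).
Definition word3 (j : I * I * I) : {fmonom I} :=
  mmul (fmu j.1.1) (mmul (fmu j.1.2) (fmu j.2)).

Lemma word2E j : word2 j = [:: j.1; j.2] :> seq I.
Proof. by rewrite /word2 fmM !fmU. Qed.
Lemma word3E j : word3 j = [:: j.1.1; j.1.2; j.2] :> seq I.
Proof. by rewrite /word3 !fmM !fmU. Qed.

Lemma word1_inj : injective word1.
Proof. by move=> i j /(congr1 (fun m : fmonom _ => m : seq I)); rewrite !fmU => -[]. Qed.
Lemma word2_inj : injective word2.
Proof.
move=> [a b] [c d] /(congr1 (fun m : fmonom _ => m : seq I)).
by rewrite !word2E => -[-> ->].
Qed.
Lemma word3_inj : injective word3.
Proof.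
move=> [[a b] c] [[a' b'] c'] /(congr1 (fun m : fmonom _ => m : seq I)).
by rewrite !word3E => -[-> -> ->].
Qed.

Lemma word1_deg i : fdeg (word1 i) = 1%N. Proof. exact: fdegU. Qed.
Lemma word2_deg j : fdeg (word2 j) = 2%N. Proof. by rewrite fdegE word2E. Qed.
Lemma word3_deg j : fdeg (word3 j) = 3%N. Proof. by rewrite fdegE word3E. Qed.

Lemma fm_inj (m1 m2 : {fmonom I}) : m1 = m2 :> seq I -> m1 = m2.
Proof. by move=> e; apply/eqP; rewrite fmP e. Qed.

Lemma word1_surj m : fdeg m = 1%N -> exists j, word1 j = m.
Proof.
move=> dm; have : size (m : seq I) = 1%N by [].
case e : (m : seq I) => [|a []] // _.
by exists a; apply: fm_inj; rewrite fmU e.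
Qed.
Lemma word2_surj m : fdeg m = 2%N -> exists j, word2 j = m.
Proof.
move=> dm; have : size (m : seq I) = 2%N by [].
case e : (m : seq I) => [|a [|b []]] // _.
by exists (a, b); apply: fm_inj; rewrite word2E e.
Qed.
Lemma word3_surj m : fdeg m = 3%N -> exists j, word3 j = m.
Proof.
move=> dm; have : size (m : seq I) = 3%N by [].
case e : (m : seq I) => [|a [|b [|c []]]] // _.
by exists (a, b, c); apply: fm_inj; rewrite word3E e.
Qed.

Lemma qsym_two_sided : two_sided_ideal (qsym_ideal q R).
Proof.
split=> [J hJ _|x y xJ yJ J hJ gJ|a x xJ J hJ gJ|a x xJ J hJ gJ].
- by case: hJ.
- by have [_ JD _ _] := hJ; exact: JD (xJ J hJ gJ) (yJ J hJ gJ).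
- by have [_ _ Jl _] := hJ; exact: Jl (xJ J hJ gJ).
- by have [_ _ _ Jr] := hJ; exact: Jr (xJ J hJ gJ).
Qed.

Lemma iota2_tens2 f : iota2 (tens2 f) = of_coefs word2 f.
Proof.
transitivity (\sum_i \sum_j f (i, j) *: monomial (word2 (i, j))); last first.
  by rewrite pair_bigA; apply: eq_bigr => -[].
apply: eq_bigr => i _; apply: eq_bigr => j _.
by rewrite mxE -letterM_monomial.
Qed.

Lemma ideal_sum (B : nzRingType) (J : B -> Prop) (T : eqType) (s : seq T)
    (F : T -> B) :
  two_sided_ideal J -> (forall t, t \in s -> J (F t)) ->
  J (\sum_(t <- s) F t).
Proof.
by case=> J0 JD _ _ JF; rewrite big_seq; apply: big_ind.
Qed.

Lemma qsym_relation f :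
  qsym_ideal q R (of_coefs word2 (op2 r f - q *: f)).
Proof.
move=> J _; apply; exists (R (tens2 f) - q *: tens2 f).
  have -> : R (tens2 f) - q *: tens2 f = (R - q *: \1)%VF (tens2 f).
    by rewrite add_lfunE opp_lfunE scale_lfunE id_lfunE.
  by rewrite memv_img ?memvf.
rewrite -iota2_tens2 R_tens2; congr iota2.
by apply/matrixP => a b; rewrite !mxE fspaceD fspaceN fspaceZ.
Qed.

Lemma qsym_dim1 s : qsym_dim q R 1 s -> (s <= \dim {:V})%N.
Proof.
move=> hs; have := @dim_mod_add_le k V 1 I word1 word1_inj word1_deg word1_surj
  _ s 0%VS qsym_two_sided hs.
rewrite dimv0 addn0 card_ord; apply => f; rewrite memv0 => /eqP ->.
rewrite /of_coefs big1 => [|j _]; first by have [] := qsym_two_sided.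
by rewrite fspace0 scale0r.
Qed.

Definition first_slice (w : fspace k (I * I * I)%type) (a : I) :
  fspace k (I * I)%type := [ffun j : I * I => w (a, j.1, j.2)].

Lemma of_coefs3E f : of_coefs word3 f =
  \sum_a \sum_b \sum_c f (a, b, c) *: (letter a * letter b * letter c).
Proof.
rewrite !pair_bigA; apply: eq_bigr => -[[a b] c] _ /=; congr (_ *: _).
by rewrite -mulrA /word3 -2!letterM_monomial.
Qed.

Lemma of_coefs2E f : of_coefs word2 f =
  \sum_a \sum_b f (a, b) *: (letter a * letter b).
Proof.
rewrite !pair_bigA; apply: eq_bigr => -[a b] _ /=; congr (_ *: _).
by rewrite /word2 -letterM_monomial.
Qed.

Lemma of_coefs3_last f :
  of_coefs word3 f = \sum_c of_coefs word2 (last_slice f c) * letter c.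
Proof.
rewrite of_coefs3E.
under eq_bigr => a _ do rewrite exchange_big.
rewrite exchange_big; apply: eq_bigr => c _ /=.
rewrite of_coefs2E mulr_suml; apply: eq_bigr => a _.
rewrite mulr_suml; apply: eq_bigr => b _.
by rewrite ffunE -scalerAl.
Qed.

Lemma of_coefs3_first f :
  of_coefs word3 f = \sum_a letter a * of_coefs word2 (first_slice f a).
Proof.
rewrite of_coefs3E; apply: eq_bigr => a _.
rewrite of_coefs2E mulr_sumr; apply: eq_bigr => b _.
rewrite mulr_sumr; apply: eq_bigr => c _.
by rewrite ffunE -scalerAr mulrA.
Qed.

(** Only the inclusion of V (x) Im(R - q) + Im(R - q) (x) V in the ideal is
    needed, because sym3_cover bounds the codimension of this space. *)
Lemma qsym_dim3 s : hecke_tensor r q (-1) -> braided (op3_1 r) (op3_2 r) ->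
    q - -1 != 0 -> q ^+ 2 - q * -1 + (-1) ^+ 2 != 0 ->
  qsym_dim q R 3 s -> (s <= \dim (sym3 (op3_1 r) (op3_2 r) q))%N.
Proof.
move=> hr br q2 q3 hs.
pose N := (limg (op3_1 r - q *: \1)%VF + limg (op3_2 r - q *: \1)%VF)%VS.
have le1 : (s + \dim N <= #|{: I * I * I}|)%N.
  apply: (dim_mod_add_le word3_inj word3_deg word3_surj qsym_two_sided hs).
  have [J0 JD Jl Jr] := qsym_two_sided => f.
  case/memv_addP => _ /memv_imgP[u _ ->] [_ /memv_imgP[v _ ->] ->].
  rewrite !(add_lfunE, opp_lfunE, scale_lfunE, id_lfunE).
  rewrite -[op3_1 r u - _]scale1r of_coefs_linear scale1r; apply: JD.
    rewrite of_coefs3_last; apply: ideal_sum qsym_two_sided _ => c _; apply: Jr.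
    have -> : last_slice (op3_1 r u - q *: u) c =
        op2 r (last_slice u c) - q *: last_slice u c.
      apply/ffunP => -[a b]; rewrite ffunE !(fspaceD, fspaceN, fspaceZ).
      rewrite op3_1E op2E ffunE; congr (_ - _).
      by apply: eq_act => ? ?; rewrite ffunE.
    exact: qsym_relation.
  rewrite of_coefs3_first; apply: ideal_sum qsym_two_sided _ => a _; apply: Jl.
  have -> : first_slice (op3_2 r v - q *: v) a =
      op2 r (first_slice v a) - q *: first_slice v a.
    apply/ffunP => -[b c]; rewrite ffunE !(fspaceD, fspaceN, fspaceZ).
    rewrite op3_2E op2E ffunE; congr (_ - _).
    by apply: eq_act => ? ?; rewrite ffunE.
  exact: qsym_relation.
have := sym3_cover br q2 (op3_1_quadratic hr) (op3_2_quadratic hr) q3.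
rewrite -/N => cover.
have := dimv_sum_cap (sym3 (op3_1 r) (op3_2 r) q) N.
rewrite cover dim_fspace => e; rewrite -(leq_add2r (\dim N)) -e.
exact: leq_trans le1 (leq_addr _ _).
Qed.

(** A two-sided ideal containing the relations whose part of degree 2 is
    visibly Im(R - q); it contains everything of degree at least 3. *)
Definition low_ideal (x : A) : Prop :=
  (forall m, (fdeg m < 2)%N -> mcoeff m x = 0) /\
  coefs_fun word2 x \in limg (op2 r - q *: \1)%VF.

Lemma low_idealD x y : low_ideal x -> low_ideal y -> low_ideal (x + y).
Proof.
move=> [x1 x2] [y1 y2]; split=> [m dm|].
  by rewrite mcoeffD x1 // y1 // addr0.
by rewrite -[x]scale1r coefs_linear scale1r memvD.
Qed.

Lemma low_ideal0 : low_ideal 0.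
Proof.
split=> [m _|]; first exact: mcoeff0.
have -> : coefs_fun word2 (0 : A) = 0.
  by apply/ffunP => j; rewrite fspace0 ffunE mcoeff0.
exact: mem0v.
Qed.

Lemma low_ideal_scale c x : low_ideal x -> low_ideal (c *: x).
Proof.
move=> [x1 x2]; split=> [m dm|]; first by rewrite mcoeff_scale x1 ?mulr0.
have -> : coefs_fun word2 (c *: x) = c *: coefs_fun word2 x.
  by apply/ffunP => j; rewrite fspaceZ !ffunE mcoeff_scale.
exact: memvZ.
Qed.

Lemma low_ideal_high c m : (2 < fdeg m)%N -> low_ideal (mkmalgU m c).
Proof.
move=> dm; split=> [m' dm'|].
  by rewrite mcoeffU; case: eqP dm' => // <-; lia.
have -> : coefs_fun word2 (mkmalgU m c) = 0.
  apply/ffunP => j; rewrite fspace0 ffunE mcoeffU.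
  by case: eqP dm => // ->; rewrite word2_deg.
exact: mem0v.
Qed.

Lemma low_ideal_sum (T : eqType) (s : seq T) (F : T -> A) :
  (forall t, t \in s -> low_ideal (F t)) -> low_ideal (\sum_(t <- s) F t).
Proof.
move=> hF; rewrite big_seq; apply: big_ind => //; first exact: low_ideal0.
exact: low_idealD.
Qed.

Lemma low_ideal_deg x m : low_ideal x -> m \in msupp x -> (1 < fdeg m)%N.
Proof.
move=> [x1 _]; rewrite -mcoeff_neq0 ltnNge; apply: contraNN => dm.
by rewrite x1.
Qed.

Lemma low_two_sided : two_sided_ideal low_ideal.
Proof.
split=> [||a x hx|a x hx]; [exact: low_ideal0|exact: low_idealD| |].
  rewrite [a]monalgE mulr_suml; apply: low_ideal_sum => m _.
  have [m0|m0] := posnP (fdeg m).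
    rewrite (fdeg_eq0I m0) mul_malgC; exact: low_ideal_scale.
  rewrite malgM_def fgmulUg; apply: low_ideal_sum => m' m's.
  by apply: low_ideal_high; rewrite fdegM; have := low_ideal_deg hx m's; lia.
rewrite [a]monalgE mulr_sumr; apply: low_ideal_sum => m _.
have [m0|m0] := posnP (fdeg m).
  rewrite (fdeg_eq0I m0).
  have -> c : x * c%:MP = c *: x.
    by rewrite -[c%:MP]mulr1 mul_malgC -tensor_algebra_scaleAr mulr1.
  exact: low_ideal_scale.
rewrite malgM_def fgmulgU; apply: low_ideal_sum => m' m's.
by apply: low_ideal_high; rewrite fdegM; have := low_ideal_deg hx m's; lia.
Qed.

Lemma qsym_dim2 s : hecke_tensor r q (-1) -> 
  qsym_dim q R 2 s -> (\dim (leigenspace (op2 r) q) <= s)%N.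
Proof.
move=> hr hs.
pose N := limg (op2 r - q *: \1)%VF.
have : (#|{: I * I}| <= s + \dim N)%N.
  apply: (dim_mod_add_ge word2_inj word2_deg hs) => x xq.
  suff [] : low_ideal x by [].
  apply: xq; first exact: low_two_sided.
  move=> _ [t /memv_imgP[u _ ->] ->].
  rewrite !(add_lfunE, opp_lfunE, scale_lfunE, id_lfunE).
  pose f : fspace k (I * I)%type := [ffun j : I * I => (u : 'M[k]_(_, _)) j.1 j.2].
  have -> : u = tens2 f by apply/matrixP => a b; rewrite mxE ffunE.
  have -> : R (tens2 f) - q *: tens2 f = tens2 ((op2 r - q *: \1)%VF f).
    rewrite R_tens2 !(add_lfunE, opp_lfunE, scale_lfunE, id_lfunE).
    by apply/matrixP => a b; rewrite !mxE fspaceD fspaceN fspaceZ.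
  rewrite iota2_tens2; split; last by rewrite of_coefsK ?memv_img ?memvf //; exact: word2_inj.
  move=> m dm; apply/eqP; rewrite mcoeff_eq0.
  by apply/negP => /(of_coefs_homog word2_deg) e; rewrite e in dm.
rewrite -(dim_fspace k) -(limg_ker_dim (op2 r - q *: \1)%VF fullv) capfv.
by rewrite leq_add2r.
Qed.

End LowDegrees.

(** * Birank (1,1) *)

(** Comparison of the coefficients of t, t^2, t^3; it yields s2^2 = s1 s3. *)
Lemma birank_series (F : realType) (s : nat -> nat) (a b : F) :
    series_eq_frac (fun n => (s n)%:R) (1 + a *: 'X) (1 - b *: 'X) ->
  [/\ (s 1)%:R = a + b, (s 2)%:R = b * (s 1)%:R :> F &
      (s 3)%:R = b * (s 2)%:R :> F].
Proof.
move=> e.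
have r0 : (1 - b *: 'X : {poly F})`_0 = 1.
  by rewrite !coefE /= mulr0 subr0.
have r1 : (1 - b *: 'X : {poly F})`_1 = - b.
  by rewrite !coefE /= mulr1 sub0r.
have r2 n : (1 - b *: 'X : {poly F})`_n.+2 = 0.
  by rewrite !coefE /= mulr0 subr0.
have p0 : (1 + a *: 'X : {poly F})`_0 = 1.
  by rewrite !coefE /= mulr0 addr0.
have p1 : (1 + a *: 'X : {poly F})`_1 = a.
  by rewrite !coefE /= mulr1 add0r.
have p2 n : (1 + a *: 'X : {poly F})`_n.+2 = 0.
  by rewrite !coefE /= mulr0 addr0.
have s0 : (s 0)%:R = 1 :> F.
  by have := e 0; rewrite big_ord1 r0 p0 mulr1.
have s1 : (s 1)%:R = a + b.
  have := e 1; rewrite !big_ord_recr big_ord0 /= r1 r0 p1 add0r s0 => <-; ring.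
have s2 : (s 2)%:R = b * (s 1)%:R.
  apply/eqP; rewrite -subr_eq0 -(p2 0); apply/eqP.
  rewrite -(e 2) !big_ord_recr big_ord0 /= r2 r1 r0; ring.
split=> //; apply/eqP; rewrite -subr_eq0 -(p2 1); apply/eqP.
rewrite -(e 3) !big_ord_recr big_ord0 /= !r2 r1 r0; ring.
Qed.

Theorem mainTheorem4 (F : realType) (k : fieldType) (V : vectType k)
  (q : k) (R : 'End(V \ox V))
  (chark : [pchar k] =i pred0)
  (heckeR : hecke_symmetry q R)
  (birankR : birank_1_1 F q R)
  (q_not_root : forall n : nat, (1 < n)%N -> ~~ n.-primitive_root q) :
  \dim {:V} = 2%N.
Proof.
case: heckeR => yb q0 hecke /bij_inj hd_inj.
case: birankR => s hs [a [b [a0 b0 /birank_series[s1 s2 s3]]]].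
have hr := rcoef_hecke hecke; have br := rcoef_braided yb.
have cl := rcoef_closed hd_inj.
have nat0 n : (n.+1%:R : k) != 0 by rewrite (iffLR (pcharf0P k) chark).
have root1 n : (0 < n)%N -> q ^+ n = 1 -> q = 1.
  move=> n0 /(prim_order_exists n0)[[|[|m]] qm _].
  - by have := prim_order_gt0 qm.
  - by have := prim_expr_order qm; rewrite expr1.
  - by have := q_not_root m.+2 isT; rewrite qm.
have q2 : q - -1 != 0.
  apply: contra_neq (nat0 1%N) => q1.
  have qN : q = -1 by apply/eqP; rewrite -subr_eq0 q1.
  have : q = 1 by apply: (root1 2%N) => //; rewrite qN sqrrN expr1n.
  by rewrite -[2%:R]/(1 + 1) => {2}<-; rewrite qN subrr.
have q3 : q ^+ 2 - q * -1 + (-1) ^+ 2 != 0.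
  apply: contra_neq (nat0 2%N) => q1.
  have : q = 1.
    apply: (root1 3%N) => //; apply/eqP; rewrite -subr_eq0; apply/eqP.
    by rewrite -[RHS](mulr0 (q - 1)) -q1; ring.
  by move=> qE; rewrite -q1 qE; ring.
have n1 : -1 != 0 :> k by rewrite oppr_eq0 oner_eq0.
have d1 := qsym_dim1 (hs 1%N).
have d2 := qsym_dim2 hr (hs 2%N).
have d3 := qsym_dim3 hr br q2 q3 (hs 3%N).
have s13 : (s 2 * s 2 = s 3 * s 1)%N.
  apply/eqP; rewrite -(eqr_nat F) !natrM s3; apply/eqP.
  rewrite {1}s2; ring.
have le2 : (\dim {:V} <= 2)%N.
  rewrite -[X in (X <= _)%N]card_ord; apply: (card_le2 q0 n1 q2 q3 hr br cl).
  by rewrite card_ord (leq_trans (leq_mul d2 d2)) // s13 leq_mul.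
have s1_gt0 : (0 < s 1)%N by rewrite -(ltr_nat F) s1 addr_gt0.
move: d1 le2; case: (\dim {:V}) => [|[|[//|//]]]; first by rewrite leqNgt s1_gt0.
move=> s1_le1 _; have s11 : s 1 = 1%N by apply/eqP; rewrite eqn_leq s1_le1.
have : (0 < s 2 < 1)%N.
  rewrite -!(ltr_nat F) s2 s11 mulr1 b0 /=.
  by move: s1; rewrite s11 => ->; rewrite ltrDr.
by case: (s 2).
Qed.
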